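(* Let $n \geq 1$ and let $L$ be a Lie subalgebra of $\mathbb{W}_n$ with $\mathrm{GKdim}(L) = n$. Then $U(L)$ is not noetherian.
   Context: $\Bbbk$ is a field of characteristic zero. $\mathbb{W}_n = \mathrm{Der}(\Bbbk[x_1,\dots,x_n]) = \sum_{i=1}^n \Bbbk[x_1,\dots,x_n]\partial_i$ with $\partial_i = \partial/\partial x_i$. $\mathrm{GKdim}$ denotes the Gelfand--Kirillov dimension of a Lie algebra (the supremum over finitely generated subalgebras $L'$, generated by a finite-dimensional subspace $V$, of the growth rate $\limsup_k \log\dim(V + C_1(V)+\dots+C_k(V))/\log k$, where $C_0(V)=V$ and $C_k(V) = [C_{k-1}(V),V]$). Noetherian means left and right noetherian. *)

(* Defs.v *)
From mathcomp Require Import all_boot all_algebra.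
From mathcomp Require Import monalg mpoly.
From mathcomp Require Import all_classical all_reals all_analysis.

Set Implicit Arguments.
Unset Strict Implicit.
Unset Printing Implicit Defensive.

Import GRing.Theory Num.Theory.
Local Open Scope ring_scope.
Local Open Scope classical_set_scope.

Definition span (k : fieldType) (V : lmodType k) (A : set V) : set V :=
  [set v | exists (m : nat) (c : 'I_m -> k) (x : 'I_m -> V),
             (forall i, A (x i)) /\ v = \sum_(i < m) c i *: x i].

Definition lin_indep (k : fieldType) (V : lmodType k) (s : seq V) : Prop :=
  forall c : 'I_(size s) -> k,
    \sum_(i < size s) c i *: s`_i = 0 -> forall i, c i = 0.

Definition dimE (R : realType) (k : fieldType) (V : lmodType k) (S : set V)
  : \bar R :=
  ereal_sup [set ((size s)%:R)%:E | s in
               [set s : seq V | (forall x, x \in s -> S x) /\ lin_indep s]].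

Fixpoint Cspace (k : fieldType) (V : lmodType k) (br : V -> V -> V)
    (vs : seq V) (j : nat) : set V :=
  match j with
  | 0 => span [set x | x \in vs]
  | j'.+1 => span [set br x y | x in Cspace br vs j' & y in span [set x | x \in vs]]
  end.

Definition Gspace (k : fieldType) (V : lmodType k) (br : V -> V -> V)
    (vs : seq V) (j : nat) : set V :=
  span [set x | exists i, (i <= j)%N /\ Cspace br vs i x].

Definition growth_ratio (R : realType) (k : fieldType) (V : lmodType k)
    (br : V -> V -> V) (vs : seq V) (j : nat) : R :=
  ln (fine (dimE R (Gspace br vs j))) / ln (j%:R).

Definition growth_rate (R : realType) (k : fieldType) (V : lmodType k)
    (br : V -> V -> V) (vs : seq V) : \bar R :=
  limn_esup (fun j => (growth_ratio R br vs j)%:E).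

(* GKdim(L) = sup over finite-dimensional subspaces V0 = span vs of L
   (each generating a finitely generated subalgebra L') of the growth
   rate. *)
Definition GKdim (R : realType) (k : fieldType) (V : lmodType k)
    (br : V -> V -> V) (L : set V) : \bar R :=
  ereal_sup [set growth_rate R br vs | vs in
               [set vs : seq V | forall x, x \in vs -> L x]].

(* The Witt algebra W_n = Der(k[x_1..x_n]) = sum_i k[x]d_i.            *)
(* An element X = sum_i f_i d_i is represented by (f_i)_i.             *)

Definition Witt (k : fieldType) (n : nat) := {ffun 'I_n -> mpoly.mpoly n k}.

(* [sum_i f_i d_i, sum_j g_j d_j] = sum_j (sum_i f_i d_i g_j - g_i d_i f_j) d_j *)
Definition wbracket (k : fieldType) (n : nat) (X Y : Witt k n) : Witt k n :=
  [ffun j => \sum_(i < n) (X i * mpoly.mderiv i (Y j)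
                           - Y i * mpoly.mderiv i (X j))].

Definition is_Lie_subalgebra (k : fieldType) (n : nat) (L : {pred Witt k n})
  : Prop :=
  [/\ 0 \in L,
      forall x y, x \in L -> y \in L -> x + y \in L,
      forall (a : k) x, x \in L -> a *: x \in L
    & forall x y, x \in L -> y \in L -> wbracket x y \in L].

(* Universal enveloping algebra U(L) = k<L> / J, where k<L> is the free *)
(* associative algebra on the set L and J is the two-sided ideal        *)
(* generated by  z - (a x + y)  (z = a x + y in L)  and                 *)
(* x y - y x - z  (z = [x,y] in L).  (k<L>/(linearity relations) is the *)
(* tensor algebra T(L).)                                                *)

Definition Lelt (k : fieldType) (n : nat) (L : {pred Witt k n}) :=
  {x : Witt k n | x \in L}.

Definition freeAlg (k : fieldType) (n : nat) (L : {pred Witt k n}) :=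
  monalg.malg (monalg.fmonom (Lelt L)) k.

Definition letter (k : fieldType) (n : nat) (L : {pred Witt k n}) (x : Lelt L)
  : freeAlg L :=
  monalg.mkmalgU (monalg.fmu x) 1.

Definition UL_relations (k : fieldType) (n : nat) (L : {pred Witt k n})
  : set (freeAlg L) :=
  [set r | (exists (a : k) (x y z : Lelt L),
              val z = a *: val x + val y /\
              r = letter z - (a *: letter x + letter y))
        \/ (exists x y z : Lelt L,
              val z = wbracket (val x) (val y) /\
              r = letter x * letter y - letter y * letter x - letter z)].

Definition UL_ideal (k : fieldType) (n : nat) (L : {pred Witt k n})
  : set (freeAlg L) :=
  span [set v | exists (a r b : freeAlg L), @UL_relations _ _ L r /\ v = a * r * b].

(* Noetherianity of a quotient ring A/J, stated through the (standard)  *)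
(* correspondence between left (resp. right) ideals of A/J and left     *)
(* (resp. right) ideals of A containing J.                              *)

Definition left_ideal (A : pzRingType) (I : set A) : Prop :=
  [/\ I 0, forall x y, I x -> I y -> I (x + y) & forall a x, I x -> I (a * x)].

Definition right_ideal (A : pzRingType) (I : set A) : Prop :=
  [/\ I 0, forall x y, I x -> I y -> I (x + y) & forall a x, I x -> I (x * a)].

Definition quot_left_noetherian (A : pzRingType) (J : set A) : Prop :=
  forall I : nat -> set A,
    (forall m, left_ideal (I m) /\ J `<=` I m /\ I m `<=` I m.+1) ->
    exists N, forall m, (N <= m)%N -> I m = I N.

Definition quot_right_noetherian (A : pzRingType) (J : set A) : Prop :=
  forall I : nat -> set A,
    (forall m, right_ideal (I m) /\ J `<=` I m /\ I m `<=` I m.+1) ->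
    exists N, forall m, (N <= m)%N -> I m = I N.

Definition quot_noetherian (A : pzRingType) (J : set A) : Prop :=
  quot_left_noetherian J /\ quot_right_noetherian J.

Definition UL_noetherian (k : fieldType) (n : nat) (L : {pred Witt k n})
  : Prop := quot_noetherian (@UL_ideal _ _ L).

(* Main.v *)
(** Let [U(L)] act through the diagonal action of [L] on functions of three
    points [p], [q], [q'] and of two covectors [alpha], [beta] at [p], and
    filter these functions by the order of vanishing [jetV] along [p = q = q'].
    The function [e = <alpha, q - p> <beta, q' - p>] vanishes to order 2, and
    [L e] vanishes to order 3.  If [u] maps order 3 to order [j + 1], then
    [u (U(L)_+ e)] is zero modulo order [j + 1]; hence, if [U(L)] is right
    noetherian, the classes [u e] of all such [u] span a finite-dimensional
    space, which is an [L]-module.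

    A symmetric tensor [sum lam_ij X_i (x) X_j] vanishing to order [j >= 4] on the
    diagonal gives such a [u = sum lam_ij X_i X_j], and its [j]-jet is read off
    [u e].  If [L] is infinite-dimensional, some nonzero [Y] in [L] kills all these
    jets, which are therefore determined by their restrictions to a hyperplane
    transverse to [Y].  Doing this for every [j] embeds the symmetric square of the
    elements of degree at most [m] of [L] in a space of dimension
    [O(m ^ (2 n - 1))].  So that part of [L] has dimension [O(m ^ (n - 1/2))], and
    [GKdim L < n]. *)

From HB Require Import structures.
Require Import Defs.
From mathcomp Require Import all_boot all_order all_algebra.
From mathcomp Require Import monalg mpoly.
From mathcomp Require Import all_classical all_reals all_analysis.
From mathcomp Require Import zify ring.

Set Implicit Arguments.
Unset Strict Implicit.
Unset Printing Implicit Defensive.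

Import Order.TTheory GRing.Theory Num.Theory.
Local Open Scope ring_scope.

Local Notation "{ 'mpoly' T [ n ] }" := (mpoly.mpoly n T) : type_scope.

(** * Vector fields as derivations of a polynomial ring *)

HB.lock Definition vact (k : fieldType) (N : nat) (U : Witt k N) (g : {mpoly k[N]}) :
  {mpoly k[N]} := \sum_(i < N) U i * g^`M(i).

Section VectorFields.
Variables (k : fieldType) (N : nat).
Implicit Types (g h : {mpoly k[N]}) (U V : Witt k N).

Lemma mderivU (i j : 'I_N) : ('X_i : {mpoly k[N]})^`M(j) = (i == j)%:R.
Proof.
rewrite mderivX mnm1E; case: eqP => [->|_]; last by rewrite scale0r.
by rewrite scale1r -mpolyX0; congr ('X_[_]); apply/mnmP=> l; rewrite mnmBE subnn mnm0E.
Qed.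

Lemma mderiv_sum (I : Type) (r : seq I) (Q : pred I) (F : I -> {mpoly k[N]}) i :
  (\sum_(x <- r | Q x) F x)^`M(i) = \sum_(x <- r | Q x) (F x)^`M(i).
Proof. exact: raddf_sum. Qed.

Lemma wittP (c : k) U V i : (c *: U + V) i = c *: U i + V i.
Proof. by rewrite !ffunE. Qed.

Lemma vactE U g : vact U g = \sum_(i < N) U i * g^`M(i).
Proof. by rewrite unlock. Qed.

Lemma vact_is_linear U : linear (vact U).
Proof.
move=> c g h; rewrite !vactE scaler_sumr -big_split; apply: eq_bigr => i _.
by rewrite mderivD mderivZ mulrDr -scalerAr.
Qed.

HB.instance Definition _ U :=
  GRing.isLinear.Build k {mpoly k[N]} {mpoly k[N]} _ (vact U) (vact_is_linear U).

Lemma vactM U g h : vact U (g * h) = vact U g * h + g * vact U h.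
Proof.
rewrite !vactE mulr_suml mulr_sumr -big_split; apply: eq_bigr => i _ /=.
by rewrite mderivM; ring.
Qed.

Lemma vact_sum U (I : Type) (r : seq I) (Q : pred I) (F : I -> {mpoly k[N]}) :
  vact U (\sum_(x <- r | Q x) F x) = \sum_(x <- r | Q x) vact U (F x).
Proof. exact: raddf_sum. Qed.

Lemma vactX U i : vact U 'X_i = U i.
Proof.
rewrite !vactE (bigD1 i) //= mderivU eqxx mulr1 big1 ?addr0 // => j /negPf ji.
by rewrite mderivU eq_sym ji mulr0.
Qed.

Lemma mderiv_vact U i g :
  (vact U g)^`M(i) = vact U (g^`M(i)) + \sum_(j < N) (U j)^`M(i) * g^`M(j).
Proof.
rewrite !vactE mderiv_sum -big_split; apply: eq_bigr => j _ /=.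
by rewrite mderivM addrC mderiv_comm.
Qed.

Lemma wbracketE U V i : wbracket U V i = vact U (V i) - vact V (U i).
Proof. by rewrite !vactE ffunE sumrB. Qed.

End VectorFields.

Section DerivationExt.
Variables (k : fieldType) (n N : nat).

(** The kernel of a derivation along [phi] contains [1] and is closed under products and linear
    combinations. Applied to the difference of two maps, this reduces the identities below to a
    check on the variables. *)
Lemma derivation_ext (phi : {rmorphism {mpoly k[n]} -> {mpoly k[N]}})
    (D : {mpoly k[n]} -> {mpoly k[N]}) :
  linear D -> (forall f g, D (f * g) = D f * phi g + phi f * D g) ->
  (forall i, D 'X_i = 0) -> forall f, D f = 0.
Proof.
move=> Dlin DM DX.
have D0 : D 0 = 0 by have := Dlin (-1) 0 0; rewrite scaler0 addr0 scaleN1r addNr.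
have D1 : D 1 = 0.
  have := DM 1 1; rewrite mulr1 rmorph1 mulr1 mul1r => /esym/eqP.
  by rewrite -subr_eq0 addrK => /eqP.
have DMon m : D 'X_[m] = 0.
  rewrite mpolyXE_id; apply: (big_ind (fun h => D h = 0)) => //.
    by move=> f g Df Dg; rewrite DM Df Dg mul0r mulr0 addr0.
  move=> i _; elim: (m i) => [|l IH]; first by rewrite expr0.
  by rewrite exprS DM DX IH mul0r mulr0 addr0.
move=> f; rewrite (mpolyE f); elim: (msupp f) => [|m r IH]; first by rewrite big_nil.
by rewrite big_cons Dlin DMon IH scaler0 addr0.
Qed.

Lemma lrmorphism_ext (phi psi : {lrmorphism {mpoly k[n]} -> {mpoly k[N]}}) :
  (forall i, phi 'X_i = psi 'X_i) -> phi =1 psi.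
Proof.
move=> E f; rewrite (mpolyE f) !linear_sum; apply: eq_bigr => m _.
rewrite !linearZ /= mpolyXE_id !rmorph_prod; congr (_ *: _).
by apply: eq_bigr => i _; rewrite !rmorphXn /= E.
Qed.

End DerivationExt.

(** Both sides are derivations in [g], and they agree on the variables by [wbracketE]. *)
Lemma vact_bracket (k : fieldType) (N : nat) (U V : Witt k N) g :
  vact (wbracket U V) g = vact U (vact V g) - vact V (vact U g).
Proof.
apply/eqP; rewrite -subr_eq0; apply/eqP.
pose D g := vact (wbracket U V) g - (vact U (vact V g) - vact V (vact U g)).
apply: (derivation_ext (phi := idfun) (D := D)) => [c f h|f h|i]; rewrite /D.
- by rewrite !linearP /= -!mul_mpolyC; ring.
- by rewrite !vactM !raddfD /= !vactM /=; ring.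
- by rewrite !vactX wbracketE subrr.
Qed.

(* The coordinates [xv s a] of the jet space are indexed through an opaque
   bijection, so that unification never computes in their number. *)
Lemma jet_index (n : nat) : {N : nat & {ix : 'I_5 * 'I_n -> 'I_N &
  {ixV : 'I_N -> 'I_5 * 'I_n | cancel ix ixV & cancel ixV ix}}}.
Proof.
exists #|{: 'I_5 * 'I_n}|, enum_rank, enum_val; first exact: enum_rankK.
exact: enum_valK.
Qed.

Definition jdim n := projT1 (jet_index n).

Definition ix n (s : 'I_5) (a : 'I_n) : 'I_(jdim n) := projT1 (projT2 (jet_index n)) (s, a).

HB.lock Definition pd (k : fieldType) (n : nat) (s : 'I_5) (a : 'I_n)
  (g : {mpoly k[jdim n]}) : {mpoly k[jdim n]} := g^`M(ix s a).

(** * Diagonal lift of vector fields to three points and two covectors *)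

Section Prolongation.
Variables (k : fieldType) (n : nat).
Local Notation P := {mpoly k[n]}.
Local Notation B := {mpoly k[jdim n]}.
Implicit Types (f : P) (g h : B) (s t : 'I_5) (a b c : 'I_n) (X Y : Witt k n).

(** Slots 0, 1, 2 hold the points [p], [q], [q']; slots 3, 4 hold the covectors [alpha], [beta] at
    [p]. So [s < 3] means a point, [0 < s < 3] means [q] or [q'], and [3 <= s] a covector. *)
Definition pt0 : 'I_5 := @Ordinal 5 0 isT.
Definition pt1 : 'I_5 := @Ordinal 5 1 isT.
Definition pt2 : 'I_5 := @Ordinal 5 2 isT.
Definition cov1 : 'I_5 := @Ordinal 5 3 isT.
Definition cov2 : 'I_5 := @Ordinal 5 4 isT.

Definition ixV : 'I_(jdim n) -> 'I_5 * 'I_n := s2val (projT2 (projT2 (jet_index n))).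

Lemma ixK s a : ixV (ix s a) = (s, a).
Proof. exact: (s2valP (projT2 (projT2 (jet_index n)))). Qed.

Lemma ixVK i : ix (ixV i).1 (ixV i).2 = i.
Proof. by rewrite /ix -surjective_pairing (s2valP' (projT2 (projT2 (jet_index n)))). Qed.

Lemma ix_eq s t a b : (ix s a == ix t b) = (s == t) && (a == b).
Proof. by rewrite -xpair_eqE -!ixK (can_eq (g := uncurry (@ix n))) // => i /=; have := ixVK i; case: (ixV i). Qed.

Lemma ixP (i : 'I_(jdim n)) : exists s a, i = ix s a.
Proof. by exists (ixV i).1, (ixV i).2; rewrite ixVK. Qed.

Lemma big_ix (F : 'I_(jdim n) -> B) : \sum_i F i = \sum_s \sum_a F (ix s a).
Proof.
rewrite pair_bigA /= (reindex (uncurry (@ix n))) /=; first by apply: eq_bigr => -[].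
by exists ixV => [[s a]|i] _ /=; rewrite ?ixK //; have := ixVK i; case: (ixV i).
Qed.

Definition xv s a : B := 'X_(ix s a).
Lemma pdE s a g : pd s a g = g^`M(ix s a).
Proof. by rewrite unlock. Qed.

Lemma pd_is_linear s a : linear (pd s a : B -> B).
Proof. by move=> c g h; rewrite !pdE mderivD mderivZ. Qed.

HB.instance Definition _ s a :=
  GRing.isLinear.Build k B B _ (pd s a) (pd_is_linear s a).

Lemma pdM s a g h : pd s a (g * h) = pd s a g * h + g * pd s a h.
Proof. by rewrite !pdE mderivM. Qed.

Lemma pdB s a g h : pd s a (g - h) = pd s a g - pd s a h.
Proof. exact: raddfB. Qed.

Lemma pd_sum s a (I : Type) (r : seq I) (Q : pred I) (F : I -> B) :
  pd s a (\sum_(x <- r | Q x) F x) = \sum_(x <- r | Q x) pd s a (F x).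
Proof. exact: raddf_sum. Qed.

Lemma pdC s t a b g : pd s a (pd t b g) = pd t b (pd s a g).
Proof. by rewrite !pdE mderiv_comm. Qed.

Lemma pd_xv s t a b : pd s a (xv t b) = ((t == s) && (b == a))%:R.
Proof. by rewrite pdE /xv mderivU ix_eq. Qed.

Lemma pd_const s a (z : k) : pd s a z%:MP = 0.
Proof. by rewrite pdE mderivC. Qed.

Lemma pd_vact s a U g : pd s a (vact U g) =
  vact U (pd s a g) + \sum_t \sum_b pd s a (U (ix t b)) * pd t b g.
Proof.
rewrite !pdE mderiv_vact big_ix; congr (_ + _).
by apply: eq_bigr => t _; apply: eq_bigr => b _; rewrite !pdE.
Qed.

Lemma emb_subproof s : {phi : {lrmorphism P -> B} | forall a, phi 'X_a = xv s a}.
Proof.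
exists (comp_mpoly [tuple xv s a | a < n]) => a /=.
by rewrite comp_mpolyXU nth_mktuple.
Qed.

Definition emb s : {lrmorphism P -> B} := sval (emb_subproof s).

Lemma embX s a : emb s 'X_a = xv s a.
Proof. exact: (svalP (emb_subproof s)). Qed.

Lemma pd_emb s t a f : pd t a (emb s f) = (s == t)%:R * emb s f^`M(a).
Proof.
apply/eqP; rewrite -subr_eq0; apply/eqP.
pose D f := pd t a (emb s f) - (s == t)%:R * emb s f^`M(a).
apply: (derivation_ext (phi := emb s) (D := D)) => [c f1 f2|f1 f2|i]; rewrite /D.
- by rewrite !linearP /= -!mul_mpolyC; ring.
- by rewrite rmorphM /= pdM mderivM raddfD /= !rmorphM /=; ring.
- by rewrite embX pd_xv mderivU rmorph_nat -natrM mulnb subrr.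
Qed.

Definition vfield (U : 'I_5 -> 'I_n -> B) : Witt k (jdim n) :=
  [ffun i => U (ixV i).1 (ixV i).2].

Lemma vfieldE U s a : vfield U (ix s a) = U s a.
Proof. by rewrite ffunE ixK. Qed.

Lemma vact_vfield U g : vact (vfield U) g = \sum_s \sum_a U s a * pd s a g.
Proof.
rewrite vactE big_ix; apply: eq_bigr => s _; apply: eq_bigr => a _.
by rewrite vfieldE pdE.
Qed.

(* [X] acts on three points [s < 3] and on two covectors at the first point. *)
Definition prol X s a : B :=
  if (s < 3)%N then emb s (X a)
  else - \sum_b xv s b * emb pt0 ((X b)^`M(a)).

(* Hidden behind [Qed] so that unification cannot unfold it. *)
Lemma hat_subproof X : {U : Witt k (jdim n) | forall s a, U (ix s a) = prol X s a}.
Proof. by exists (vfield (prol X)) => s a; apply: vfieldE. Qed.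

(** On covectors this is the cotangent lift, minus the transposed Jacobian of [X] at [p]; with this
    choice [hat] respects brackets. *)
Definition hat X : Witt k (jdim n) := sval (hat_subproof X).

Lemma hat_ix X s a : hat X (ix s a) = prol X s a.
Proof. exact: (svalP (hat_subproof X)). Qed.

Lemma vact_hat X g : vact (hat X) g = \sum_s \sum_a prol X s a * pd s a g.
Proof.
rewrite vactE big_ix; apply: eq_bigr => s _; apply: eq_bigr => a _.
by rewrite hat_ix pdE.
Qed.

Lemma hat_xv X s a : vact (hat X) (xv s a) = prol X s a.
Proof. by rewrite vactX hat_ix. Qed.

Lemma vact_hat_emb X s f : (s < 3)%N -> vact (hat X) (emb s f) = emb s (vact X f).
Proof.
move=> s3; rewrite vact_hat (bigD1 s) //= [X in _ + X]big1 ?addr0.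
  rewrite vactE raddf_sum; apply: eq_bigr => a _.
  by rewrite /= pd_emb eqxx mul1r /prol s3 [RHS]rmorphM.
move=> t /negPf ts; rewrite big1 // => a _.
by rewrite pd_emb eq_sym ts mul0r mulr0.
Qed.

Lemma prol_lin (z : k) X Y s a :
  prol (z *: X + Y) s a = z *: prol X s a + prol Y s a.
Proof.
rewrite /prol; case s3: (s < 3)%N; first by rewrite wittP linearP.
rewrite scalerN -opprD; congr (- _).
rewrite scaler_sumr -big_split /=; apply: eq_bigr => b _.
by rewrite wittP mderivD mderivZ linearP /= mulrDr -scalerAr.
Qed.

Lemma hat_lin (z : k) X Y : hat (z *: X + Y) = z *: hat X + hat Y.
Proof.
apply/ffunP => i; case: (ixP i) => s [a ->{i}].
rewrite [LHS]hat_ix prol_lin [RHS]wittP.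
by congr (_ *: _ + _); apply/esym/hat_ix.
Qed.

Lemma hat_bracket X Y : hat (wbracket X Y) = wbracket (hat X) (hat Y).
Proof.
apply/ffunP => i; case: (ixP i) => s [a ->{i}].
rewrite [LHS]hat_ix [RHS]wbracketE.
have -> : hat X (ix s a) = prol X s a by exact: hat_ix.
have -> : hat Y (ix s a) = prol Y s a by exact: hat_ix.
rewrite /prol; case s3: (s < 3)%N.
  by rewrite wbracketE raddfB /= !vact_hat_emb.
(* The double sum comes from [Z] moving the covector, the other sum from [Z] moving the base
   point. *)
have E Z W : vact (hat Z) (- \sum_b xv s b * emb pt0 (W b)^`M(a)) =
    \sum_b \sum_c xv s c * emb pt0 ((Z c)^`M(b) * (W b)^`M(a))
    - \sum_b xv s b * emb pt0 (vact Z (W b)^`M(a)).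
  rewrite raddfN /= vact_sum -[in RHS]sumrN -big_split -[LHS]sumrN /=.
  apply: eq_bigr => b _.
  rewrite vactM hat_xv /prol s3 vact_hat_emb // opprD; congr (_ - _).
  rewrite mulNr opprK mulr_suml; apply: eq_bigr => c _.
  by rewrite rmorphM mulrA.
(* Renaming indices collects the coefficient of each covector coordinate; what remains is the
   product rule [mderiv_vact]. *)
have F Z W : \sum_b \sum_c xv s c * emb pt0 ((Z c)^`M(b) * (W b)^`M(a)) =
    \sum_b xv s b * emb pt0 (\sum_c (W c)^`M(a) * (Z b)^`M(c)).
  rewrite exchange_big /=; apply: eq_bigr => b _.
  rewrite raddf_sum mulr_sumr; apply: eq_bigr => c _.
  by rewrite mulrC [_ * (Z b)^`M(c)]mulrC mulrC.
rewrite !E !F -!sumrB -sumrN; apply: eq_bigr => b _.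
by rewrite wbracketE mderivB !mderiv_vact raddfB !raddfD /=; ring.
Qed.

End Prolongation.

Arguments emb {k n} s.
Arguments xv {k n} s a.

(** * Order of vanishing along the diagonal and along its slices *)

Section JetFiltration.
Variables (k : fieldType) (n : nat).
Local Notation P := {mpoly k[n]}.
Local Notation B := {mpoly k[jdim n]}.
Implicit Types (o : option ('I_n * k)) (f : P) (g h : B) (s t : 'I_5).
Implicit Types (a b c : 'I_n) (X Y : Witt k n).

(* [res None] restricts to the diagonal where the three points coincide, and
   [res (Some (a, c))] to the part of the diagonal lying over [x_a = c]. *)
Definition res_coord o a : B :=
  if o is Some ac then if a == ac.1 then ac.2%:MP else xv pt0 a else xv pt0 a.

Lemma res_subproof o : {phi : {lrmorphism B -> B} |
  forall s a, phi (xv s a) = if (s < 3)%N then res_coord o a else xv s a}.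
Proof.
pose F i := let sa := ixV i in if (sa.1 < 3)%N then res_coord o sa.2 else xv sa.1 sa.2.
exists (comp_mpoly [tuple F i | i < jdim n]) => s a /=.
by rewrite comp_mpolyXU nth_mktuple /F ixK.
Qed.

Definition res o : {lrmorphism B -> B} := sval (res_subproof o).

Lemma res_pt o s a : (s < 3)%N -> res o (xv s a) = res_coord o a.
Proof. by move=> s3; rewrite (svalP (res_subproof o)) s3. Qed.

Lemma res_cov o s a : (3 <= s)%N -> res o (xv s a) = xv s a.
Proof. by move=> s3; rewrite (svalP (res_subproof o)) ltnNge s3. Qed.

(** The directions tangent to the restricted diagonal. *)
Definition free o a := if o is Some ac then a != ac.1 else true.

(** Derivative along a common translation of the three points, hence along the full diagonal. *)
Definition transl a g : B := pd pt0 a g + pd pt1 a g + pd pt2 a g.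

Lemma transl_is_linear a : linear (transl a).
Proof. by move=> c g h; rewrite /transl !linearP /= !scalerDr; ring. Qed.

HB.instance Definition _ a :=
  GRing.isLinear.Build k B B _ (transl a) (transl_is_linear a).

Lemma translM a g h : transl a (g * h) = transl a g * h + g * transl a h.
Proof. by rewrite /transl !pdM; ring. Qed.

Lemma transl_pd a s b g : transl a (pd s b g) = pd s b (transl a g).
Proof. by rewrite /transl !raddfD /= ![pd s b (pd _ _ _)]pdC. Qed.

Lemma transl_xv a s b : transl a (xv s b) = ((s < 3)%N && (b == a))%:R.
Proof.
rewrite /transl !pd_xv -!natrD; congr _%:R.
by case: s => [[|[|[|[|[|s]]]]] s5] //=; case: eqP.
Qed.

Lemma transl_emb a s f : (s < 3)%N -> transl a (emb s f) = emb s f^`M(a).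
Proof.
move=> s3; rewrite /transl !pd_emb -!mulrDl -!natrD.
suff -> : ((s == pt0) + (s == pt1) + (s == pt2) = 1)%N by rewrite mul1r.
by case: s s3 => [[|[|[|s]]] s5].
Qed.

Lemma res_emb o s f : (s < 3)%N -> res o (emb s f) = res o (emb pt0 f).
Proof.
move=> s3; apply: (lrmorphism_ext (phi := res o \o emb s) (psi := res o \o emb pt0)).
by move=> i /=; rewrite !embX !res_pt.
Qed.

Lemma res_resN o g : res o (res None g) = res o g.
Proof.
apply: (lrmorphism_ext (phi := res o \o res None) (psi := res o)) => i /=.
have [s [a ->]] := ixP i; rewrite -/(xv s a).
have [s3|s3] := ltnP s 3; first by rewrite !res_pt.
by rewrite !res_cov.
Qed.

Lemma res_pd o s a g : (3 <= s)%N -> res o (pd s a g) = pd s a (res o g).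
Proof.
move=> s3; apply/eqP; rewrite -subr_eq0; apply/eqP.
pose D g := res o (pd s a g) - pd s a (res o g).
apply: (derivation_ext (phi := res o) (D := D)) => [c f1 f2|f1 f2|i]; rewrite /D {D}.
- by rewrite !linearP /= -!mul_mpolyC; ring.
- by rewrite pdM !rmorphM rmorphD !rmorphM /= pdM; ring.
have [t [b ->]] := ixP i; rewrite -/(xv t b) pd_xv rmorph_nat.
have [t3|t3] := ltnP t 3; last by rewrite res_cov // pd_xv subrr.
have neq (u : 'I_5) : (u < 3)%N -> (u == s) = false.
  by move=> u3; apply/eqP => us; move: u3; rewrite us ltnNge s3.
rewrite res_pt // neq //= sub0r; apply/eqP; rewrite oppr_eq0; apply/eqP.
rewrite /res_coord; case: o => [[a0 z]|] /=; last by rewrite pd_xv neq.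
by case: eqP => _; [rewrite pd_const | rewrite pd_xv neq].
Qed.

(** Chain rule: on the diagonal the three points are one, and a free coordinate is still a
    coordinate after restriction. *)
Lemma res_transl o a g : free o a -> res o (transl a g) = pd pt0 a (res o g).
Proof.
move=> oa; apply/eqP; rewrite -subr_eq0; apply/eqP.
pose D g := res o (transl a g) - pd pt0 a (res o g).
apply: (derivation_ext (phi := res o) (D := D)) => [c f1 f2|f1 f2|i]; rewrite /D {D}.
- by rewrite !linearP /= -!mul_mpolyC; ring.
- by rewrite translM !rmorphM rmorphD !rmorphM /= pdM; ring.
have [t [b ->]] := ixP i; rewrite -/(xv t b) transl_xv rmorph_nat.
have [t3|t3] := ltnP t 3; last first.
  rewrite res_cov // pd_xv; suff -> : (t == pt0) = false by rewrite subrr.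
  by apply/eqP => E; move: t3; rewrite E.
rewrite res_pt //= /res_coord; case: o oa => [[a0 z]|] /= oa; last by rewrite pd_xv eqxx subrr.
case: (b =P a0) => [->|_]; last by rewrite pd_xv eqxx subrr.
by rewrite pd_const eq_sym (negPf oa) subrr.
Qed.

Lemma big_pt (F : 'I_5 -> B) : \sum_(s < 5 | (s < 3)%N) F s = F pt0 + F pt1 + F pt2.
Proof.
rewrite big_mkcond !big_ord_recl big_ord0 /= !addr0 addrA.
by congr (F _ + F _ + F _); apply: val_inj.
Qed.

(** Only derivatives in [q] and [q'] are tested; covector derivatives and free translations preserve
    the condition. For [Some (a, c)] the direction normal to [x_a = c] is not tested: the jet
    transverse to the diagonal is merely restricted to the slice. *)
Fixpoint jetV o (r : nat) g : Prop :=
  if r is r'.+1 then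
    res o g = 0 /\ forall s a, (0 < s < 3)%N -> jetV o r' (pd s a g)
  else True.

Lemma jetV_lin o r (z : k) g h : jetV o r g -> jetV o r h -> jetV o r (z *: g + h).
Proof.
elim: r g h => [//|r IH] g h [g0 Hg] [h0 Hh]; split.
  by rewrite linearP /= g0 h0 scaler0 addr0.
by move=> s a sP; rewrite linearP /=; apply: IH; [apply: Hg | apply: Hh].
Qed.

Lemma jetV0 o r : jetV o r 0.
Proof. by elim: r => [//|r IH]; split => [|s a _]; rewrite raddf0. Qed.

Lemma jetVD o r g h : jetV o r g -> jetV o r h -> jetV o r (g + h).
Proof. by move=> Vg Vh; rewrite -[g]scale1r; apply: jetV_lin. Qed.

Lemma jetVZ o r z g : jetV o r g -> jetV o r (z *: g).
Proof. by move=> Vg; rewrite -[_ *: _]addr0; apply: jetV_lin => //; apply: jetV0. Qed.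

Lemma jetVN o r g : jetV o r g -> jetV o r (- g).
Proof. by move=> Vg; rewrite -scaleN1r; apply: jetVZ. Qed.

Lemma jetVB o r g h : jetV o r g -> jetV o r h -> jetV o r (g - h).
Proof. by move=> Vg Vh; apply: jetVD => //; apply: jetVN. Qed.

Lemma jetV_sum o r (I : Type) (l : seq I) (Q : pred I) (F : I -> B) :
  (forall i, Q i -> jetV o r (F i)) -> jetV o r (\sum_(i <- l | Q i) F i).
Proof. by move=> H; apply: big_ind => //; [apply: jetV0 | apply: jetVD]. Qed.

Lemma jetV_pd o r s a g : (0 < s < 3)%N -> jetV o r g -> jetV o r.-1 (pd s a g).
Proof. by case: r => [//|r] sP [_ H]; apply: H. Qed.

Lemma jetVM o r1 r2 r g h :
  (r <= r1 + r2)%N -> jetV o r1 g -> jetV o r2 h -> jetV o r (g * h).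
Proof.
elim: r r1 r2 g h => [//|r IH] r1 r2 g h le_r Vg Vh; split.
  rewrite rmorphM; rewrite /=; case: r1 le_r Vg => [|r1] le_r Vg; last by rewrite Vg.1 mul0r.
  by case: r2 le_r Vh => [//|r2] _ Vh; rewrite Vh.1 mulr0.
move=> s a sP; rewrite pdM; apply: jetVD.
  by apply: (IH r1.-1 r2) => //; [lia | apply: jetV_pd].
by apply: (IH r1 r2.-1) => //; [lia | apply: jetV_pd].
Qed.

Lemma jetV_mull o r g h : jetV o r h -> jetV o r (g * h).
Proof. exact: (@jetVM _ 0 r). Qed.

Lemma jetV_le o r1 r g : (r <= r1)%N -> jetV o r1 g -> jetV o r g.
Proof. by move=> le_r Vg; rewrite -[g]mulr1; apply: (jetVM (r1 := r1) (r2 := 0)); rewrite ?addn0. Qed.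

Lemma jetV_resN o r g : jetV None r g -> jetV o r g.
Proof.
elim: r g => [//|r IH] g [g0 Hg]; split; first by rewrite -res_resN g0 raddf0.
by move=> s a sP; apply: IH; apply: Hg.
Qed.

Lemma jetV_pd_cov o r s a g : (3 <= s)%N -> jetV o r g -> jetV o r (pd s a g).
Proof.
move=> s3; elim: r g => [//|r IH] g [g0 Hg]; split; first by rewrite res_pd // g0 raddf0.
by move=> t b tP; rewrite pdC; apply: IH; apply: Hg.
Qed.

Lemma jetV_transl o r a g : free o a -> jetV o r g -> jetV o r (transl a g).
Proof.
move=> oa; elim: r g => [//|r IH] g [g0 Hg]; split; first by rewrite res_transl // g0 raddf0.
by move=> t b tP; rewrite -transl_pd; apply: IH; apply: Hg.
Qed.

(** A derivative in [p] is a translation, which keeps the order, minus derivatives in [q] and [q'],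
    which lower it by one. On the full diagonal every translation is free. *)
Lemma jetV_pd_pt r s a g : (s < 3)%N -> jetV None r g -> jetV None r.-1 (pd s a g).
Proof.
move=> s3 Vg; case: (posnP s) => [s0|sP]; last by apply: jetV_pd; rewrite ?sP.
have -> : pd s a g = transl a g - (pd pt1 a g + pd pt2 a g).
  have -> : s = pt0 by apply: val_inj.
  by rewrite /transl; ring.
apply: jetVB; first by apply: (jetV_le (leq_pred r)); apply: jetV_transl.
by apply: jetVD; apply: jetV_pd.
Qed.

(** A function of [p] alone is constant for the derivatives in [q] and [q'], so it factors out of
    each restriction, where it is a nonzero element of a domain. *)
Lemma jetV_cancel o r f g : res o (emb pt0 f) != 0 ->
  jetV o r (emb pt0 f * g) -> jetV o r g.
Proof.
move=> f0; elim: r g => [//|r IH] g [fg0 H]; split.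
  by move/eqP: fg0; rewrite rmorphM mulf_eq0 (negPf f0) => /eqP.
move=> s a sP; apply: IH; have := H s a sP; rewrite pdM pd_emb.
suff -> : (pt0 == s) = false by rewrite mul0r mul0r add0r.
by apply/eqP => E; move: sP; rewrite -E.
Qed.

(* Vector fields tangent to the restricted diagonal preserve the filtration. *)
Lemma jetV_vact o r (D : Witt k (jdim n)) g :
  (forall s a, (s < 3)%N -> res o (D (ix s a)) = res o (D (ix pt0 a))) ->
  (forall a, ~~ free o a -> res o (D (ix pt0 a)) = 0) ->
  (forall s a b, (0 < s < 3)%N -> pd s a (D (ix pt0 b)) = 0) ->
  jetV o r g -> jetV o r (vact D g).
Proof.
move=> Dpt Dfree Dbase.
have DE h : vact D h = \sum_s \sum_a D (ix s a) * pd s a h.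
  rewrite vactE big_ix; apply: eq_bigr => s _; apply: eq_bigr => a _.
  by rewrite pdE.
elim: r g => [//|r IH] g Vg; have [g0 Hg] := Vg; split.
  (* On the restricted diagonal the three point components of [D] agree, so they combine into
     translations in free directions. *)
  rewrite DE exchange_big raddf_sum big1 // => a _.
  rewrite raddf_sum (bigID (fun s : 'I_5 => (s < 3)%N)) /= [X in _ + X]big1 ?addr0.
    under eq_bigr => s s3 do rewrite rmorphM /= Dpt //.
    rewrite -mulr_sumr -raddf_sum /=.
    rewrite (big_pt (fun s => pd s a g)) -/(transl a g).
    case oa: (free o a); first by rewrite res_transl // g0 raddf0 mulr0.
    by rewrite Dfree ?oa ?mul0r.
  by move=> s; rewrite -leqNgt => s3; rewrite rmorphM /= res_pd // g0 raddf0 mulr0.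
(* The commutator with a derivative in [q] or [q'] contains no derivative in [p]; those in [q], [q']
   use up the spare order, and those in covectors cost nothing. *)
move=> s a sP; rewrite pd_vact; apply: jetVD; first exact/IH/Hg.
apply: jetV_sum => t _; apply: jetV_sum => b _.
case: (posnP t) => [t0|t0].
  have -> : t = pt0 by apply: val_inj.
  by rewrite Dbase // mul0r; apply: jetV0.
apply: jetV_mull; have [t3|t3] := ltnP t 3; first by apply: (jetV_pd b _ Vg); rewrite t0.
by apply: (jetV_le (leqnSn r)); apply: jetV_pd_cov.
Qed.

Lemma res_prol o X s a : (s < 3)%N -> res o (prol X s a) = res o (prol X pt0 a).
Proof. by move=> s3; rewrite /prol s3 /=; apply: res_emb. Qed.

Lemma pd_prol_pt0 X s a b : (0 < s < 3)%N -> pd s a (prol X pt0 b) = 0.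
Proof.
move=> sP; rewrite /prol /= pd_emb; suff -> : (pt0 == s) = false by rewrite mul0r.
by apply/eqP => E; move: sP; rewrite -E.
Qed.

Lemma jetV_hat r X g : jetV None r g -> jetV None r (vact (hat X) g).
Proof.
apply: jetV_vact => // [s a s3|s a b sP]; last by rewrite hat_ix pd_prol_pt0.
have -> : hat X (ix s a) = prol X s a by exact: hat_ix.
by rewrite hat_ix; apply: res_prol.
Qed.

End JetFiltration.

(** * Quadratic elements of the enveloping algebra as second-order operators *)

Section QuadraticOperators.
Variables (k : fieldType) (n D : nat) (X : 'I_D -> Witt k n).
Local Notation P := {mpoly k[n]}.
Local Notation B := {mpoly k[jdim n]}.
Implicit Types (o : option ('I_n * k)) (f : P) (g h : B) (s t : 'I_5).
Implicit Types (a b c d : 'I_n) (lam : 'M[k]_D) (be ga : 'X_{1..n}).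

(** Derivative of order [be] in [p] and [ga] in [q] of the component [(a, b)] of the tensor
    [sum lam_ij X_i(p) (x) X_j(q)], taken at [p = q]. Below, [vanish] is the order of vanishing of
    this tensor. *)
Definition Psi lam a b be ga : P :=
  \sum_i \sum_j lam i j *: ((X i a)^`M[be] * (X j b)^`M[ga]).

Definition qpair lam (u v : 'I_D -> B) : B :=
  \sum_i \sum_j lam i j *: (u i * v j).

Definition qact lam g : B :=
  \sum_i \sum_j lam i j *: vact (hat (X i)) (vact (hat (X j)) g).

Definition vanish o J lam := forall a b be ga,
  (mdeg be + mdeg ga < J)%N -> res o (emb pt0 (Psi lam a b be ga)) = 0.

Lemma mderivm_U f be c : f^`M[be]^`M(c) = f^`M[be + U_(c)].
Proof. by rewrite mderivmDm mderivmU1m. Qed.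

Lemma qpairDl lam u u' v : qpair lam (fun i => u i + u' i) v = qpair lam u v + qpair lam u' v.
Proof.
rewrite /qpair -big_split; apply: eq_bigr => i _; rewrite -big_split.
by apply: eq_bigr => j _; rewrite mulrDl scalerDr.
Qed.

Lemma qpairDr lam u v v' : qpair lam u (fun i => v i + v' i) = qpair lam u v + qpair lam u v'.
Proof.
rewrite /qpair -big_split; apply: eq_bigr => i _; rewrite -big_split.
by apply: eq_bigr => j _; rewrite mulrDr scalerDr.
Qed.

Lemma qpairMl lam g u v : qpair lam (fun i => g * u i) v = g * qpair lam u v.
Proof.
rewrite /qpair mulr_sumr; apply: eq_bigr => i _; rewrite mulr_sumr.
by apply: eq_bigr => j _; rewrite -scalerAr mulrA.
Qed.

Lemma qpairMr lam g u v : qpair lam u (fun i => g * v i) = g * qpair lam u v.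
Proof.
rewrite /qpair mulr_sumr; apply: eq_bigr => i _; rewrite mulr_sumr.
by apply: eq_bigr => j _; rewrite -scalerAr mulrCA.
Qed.

Lemma eq_qpair lam u u' v v' : u =1 u' -> v =1 v' -> qpair lam u v = qpair lam u' v'.
Proof.
by move=> Eu Ev; apply: eq_bigr => i _; apply: eq_bigr => j _; rewrite Eu Ev.
Qed.

Lemma pd_qpair lam s a u v : pd s a (qpair lam u v) =
  qpair lam (fun i => pd s a (u i)) v + qpair lam u (fun i => pd s a (v i)).
Proof.
rewrite /qpair raddf_sum -big_split; apply: eq_bigr => i _ /=.
rewrite raddf_sum -big_split; apply: eq_bigr => j _ /=.
by rewrite linearZ /= pdM scalerDr.
Qed.

Definition jcoef s a be (i : 'I_D) : B := emb s (X i a)^`M[be].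

Lemma pd_jcoef s t a b be i :
  pd t b (jcoef s a be i) = (s == t)%:R * jcoef s a (be + U_(b)) i.
Proof. by rewrite /jcoef pd_emb mderivm_U. Qed.

Lemma res_qpair o lam s t a b be ga : (s < 3)%N -> (t < 3)%N ->
  res o (qpair lam (jcoef s a be) (jcoef t b ga)) = res o (emb pt0 (Psi lam a b be ga)).
Proof.
move=> s3 t3; rewrite /qpair /Psi !raddf_sum; apply: eq_bigr => i _.
rewrite !raddf_sum; apply: eq_bigr => j _.
by rewrite /= !linearZ /= !rmorphM /= /jcoef (res_emb _ _ s3) (res_emb _ _ t3).
Qed.

(** Each derivative adds one to the order of one factor, so fewer than [r] derivatives stay in the
    range of [vanish]. The guard [0 < r] leaves out the case where there is nothing to prove. *)
Lemma jetV_jcoef o J r lam s t a b be ga : vanish o J lam -> (s < 3)%N -> (t < 3)%N ->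
  (0 < r -> r + mdeg be + mdeg ga <= J)%N ->
  jetV o r (qpair lam (jcoef s a be) (jcoef t b ga)).
Proof.
move=> van s3 t3; elim: r be ga => [//|r IH] be ga le_J; split.
  by rewrite res_qpair //; apply: van; move: (le_J isT); lia.
move=> u c _; rewrite pd_qpair.
have Hd m : (mdeg (m + U_(c)) = (mdeg m).+1)%N by rewrite mdegD mdeg1 addn1.
rewrite (eq_qpair _ (pd_jcoef _ _ _ _ _) (frefl _)) qpairMl.
rewrite (eq_qpair _ (frefl _) (pd_jcoef _ _ _ _ _)) qpairMr.
by apply: jetVD; apply: jetV_mull; apply: IH => _; rewrite Hd; move: (le_J isT); lia.
Qed.

(* Coefficient families that are B-linear in the jets of order at most
   [kap] of the vector fields [X i]. *)
Inductive jlin (kap : nat) : ('I_D -> B) -> Prop :=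
| jlin_jcoef s a be : (s < 3)%N -> (mdeg be <= kap)%N -> jlin kap (jcoef s a be)
| jlinD u v : jlin kap u -> jlin kap v -> jlin kap (fun i => u i + v i)
| jlinM g u : jlin kap u -> jlin kap (fun i => g * u i)
| jlinE u v : u =1 v -> jlin kap u -> jlin kap v.

Lemma jetV_qpair o J r lam kap kap' u v : vanish o J lam ->
  (0 < r -> r + kap + kap' <= J)%N -> jlin kap u -> jlin kap' v ->
  jetV o r (qpair lam u v).
Proof.
move=> van le_J ju jv; elim: ju v jv => {u}.
- move=> s a be s3 leb v; elim => {v}.
  + move=> t b ga t3 leg; apply: (jetV_jcoef a b van) => // r0.
    by move: (le_J r0); lia.
  + by move=> v w _ IH1 _ IH2; rewrite qpairDr; apply: jetVD.
  + by move=> g v _ IH; rewrite qpairMr; apply: jetV_mull.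
  + by move=> v w E _; rewrite (eq_qpair _ (frefl _) E).
- by move=> u u' _ IH1 _ IH2 v jv; rewrite qpairDl; apply: jetVD; [apply: IH1|apply: IH2].
- by move=> g u _ IH v jv; rewrite qpairMl; apply: jetV_mull; apply: IH.
- by move=> u u' E _ IH v jv; rewrite -(eq_qpair _ E (frefl _)); apply: IH.
Qed.

Lemma jlinW kap kap' u : (kap <= kap')%N -> jlin kap u -> jlin kap' u.
Proof.
move=> le; elim=> {u} [s a be s3 leb|u v _ IH1 _ IH2|g u _ IH|u v E _ IH].
- by apply: jlin_jcoef => //; apply: leq_trans le.
- exact: jlinD.
- exact: jlinM.
- exact: jlinE IH.
Qed.

Lemma jlin_pd kap s a u : jlin kap u ->
  jlin (kap + (s < 3)%N) (fun i => pd s a (u i)).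
Proof.
elim=> {u} [t b be t3 leb|u v _ IH1 _ IH2|g u ju IH|u v E _ IH].
- apply: (jlinE (fun i => esym (pd_jcoef t s b a be i))).
  case: eqP => [<-|_].
    by apply: jlinM; apply: jlin_jcoef => //; rewrite t3 mdegD mdeg1 leq_add2r.
  apply: (@jlinE _ (fun i => 0 * jcoef t b be i)); first by move=> i; rewrite !mul0r.
  by apply: jlinM; apply: jlin_jcoef => //; apply: leq_trans leb _; apply: leq_addr.
- by apply: jlinE (jlinD IH1 IH2) => i; rewrite raddfD.
- apply: (@jlinE _ (fun i => pd s a g * u i + g * pd s a (u i))).
    by move=> i; rewrite pdM.
  by apply: jlinD; apply: jlinM => //; apply: jlinW ju; apply: leq_addr.
- by apply: jlinE IH => i; rewrite E.
Qed.

(** The family [u0] provides the empty sum as [0 * u0], since [jlin] has no constructor for zero. *)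
Lemma jlin_sum kap (r : seq 'I_n) (F : 'I_n -> 'I_D -> B) (u0 : 'I_D -> B) : jlin kap u0 ->
  (forall b, jlin kap (F b)) -> jlin kap (fun i => \sum_(b <- r) F b i).
Proof.
move=> j0 jF; elim: r => [|b r IH].
  by apply: (jlinE _ (jlinM 0 j0)) => i; rewrite big_nil mul0r.
by apply: (jlinE _ (jlinD (jF b) IH)) => i; rewrite big_cons.
Qed.

(** Covector components involve the Jacobian of the field, hence one derivative more than point
    components. *)
Lemma jlin_prol s a : jlin (3 <= s)%N (fun i => prol (X i) s a).
Proof.
have [s3|s3] := ltnP s 3.
  apply: (@jlinE _ (jcoef s a 0%MM)); last by apply: jlin_jcoef; rewrite ?mdeg0.
  by move=> i; rewrite /jcoef mderivm0m /prol s3.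
have jc b : jlin true (jcoef pt0 b U_(a)) by apply: jlin_jcoef; rewrite ?mdeg1.
apply: (@jlinE _ (fun i => -1 * \sum_b xv s b * jcoef pt0 b U_(a) i)).
  move=> i; rewrite mulN1r /prol ltnNge s3 /=; congr (- _); apply: eq_bigr => b _.
  by rewrite /jcoef mderivmU1m.
apply: (jlinM (-1) (u := fun i => \sum_b xv s b * jcoef pt0 b U_(a) i)).
apply: (@jlin_sum _ _ (fun b i => xv s b * jcoef pt0 b U_(a) i) _ (jc a)) => b.
exact: jlinM.
Qed.

Lemma jetV_pdN r s a g : jetV None r g -> jetV None (r - (s < 3)%N) (pd s a g).
Proof.
move=> Vg; have [s3|s3] := ltnP s 3; first by rewrite subn1; apply: jetV_pd_pt.
by rewrite subn0; apply: jetV_pd_cov.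
Qed.

Lemma qactE lam g : qact lam g = \sum_s \sum_a \sum_t \sum_b
  (qpair lam (fun i => prol (X i) s a) (fun i => pd s a (prol (X i) t b)) * pd t b g
   + qpair lam (fun i => prol (X i) s a) (fun i => prol (X i) t b) * pd s a (pd t b g)).
Proof.
have E i j : vact (hat (X i)) (vact (hat (X j)) g) =
    \sum_s \sum_a \sum_t \sum_b prol (X i) s a *
     (pd s a (prol (X j) t b) * pd t b g + prol (X j) t b * pd s a (pd t b g)).
  rewrite !vact_hat; apply: eq_bigr => s _; apply: eq_bigr => a _.
  rewrite raddf_sum mulr_sumr; apply: eq_bigr => t _ /=.
  by rewrite raddf_sum mulr_sumr; apply: eq_bigr => b _; rewrite /= pdM.
rewrite /qact; under eq_bigr do under eq_bigr do rewrite E.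
have pull (F : 'I_D -> 'I_D -> 'I_5 -> 'I_n -> B) :
    \sum_i \sum_j lam i j *: \sum_s \sum_a F i j s a =
    \sum_s \sum_a \sum_i \sum_j lam i j *: F i j s a.
  rewrite pair_bigA /= [RHS]pair_bigA /=.
  under [RHS]eq_bigr do rewrite pair_bigA /=.
  rewrite exchange_big /=; apply: eq_bigr => -[i j] _ /=.
  rewrite scaler_sumr -(pair_bigA _ (fun s a => lam i j *: F i j s a)) /=.
  by apply: eq_bigr => s _; rewrite scaler_sumr.
rewrite pull; apply: eq_bigr => s _; apply: eq_bigr => a _.
rewrite pull; apply: eq_bigr => t _; apply: eq_bigr => b _.
rewrite /qpair !mulr_suml -big_split; apply: eq_bigr => i _ /=.
rewrite !mulr_suml -big_split; apply: eq_bigr => j _ /=.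
by rewrite mulrDr scalerDr -!scalerAl !mulrA.
Qed.

(** The coefficients gain [J] orders and each of the two fields costs one: a point derivative costs
    it on [g], a covector derivative costs it on the coefficient, which then contains a Jacobian. In
    the first-order part, differentiating the inner coefficient plays the same role. *)
Lemma jetV_qact o J lam r r' g : vanish o J lam -> jetV None r' g ->
  (r + 2 <= J + r')%N -> jetV o r (qact lam g).
Proof.
move=> van Vg le_r; rewrite qactE.
apply: jetV_sum => s _; apply: jetV_sum => a _.
apply: jetV_sum => t _; apply: jetV_sum => b _.
have tE : (t < 3)%N = ~~ (3 <= t)%N by rewrite ltnNge.
have sE : (s < 3)%N = ~~ (3 <= s)%N by rewrite ltnNge.
apply: jetVD.
- apply: (@jetVM _ _ _ (J - 1 - (3 <= t)%N) (r' - (t < 3)%N)).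
  + by rewrite tE; case: (3 <= t)%N; lia.
  + apply: (jetV_qpair van _ (jlin_prol s a) (jlin_pd s a (jlin_prol t b))).
    by rewrite sE; case: (3 <= s)%N; case: (3 <= t)%N; lia.
  + by apply: jetV_resN; apply: jetV_pdN.
- apply: (@jetVM _ _ _ (J - (3 <= s)%N - (3 <= t)%N) (r' - (t < 3)%N - (s < 3)%N)).
  + by rewrite tE sE; case: (3 <= t)%N; case: (3 <= s)%N; lia.
  + apply: (jetV_qpair van _ (jlin_prol s a) (jlin_prol t b)).
    by case: (3 <= s)%N; case: (3 <= t)%N; lia.
  + by apply: jetV_resN; do 2!apply: jetV_pdN.
Qed.

End QuadraticOperators.

(** * The test function and how it reads off second derivatives *)

Section TestFunction.
Variables (k : fieldType) (n : nat).
Local Notation P := {mpoly k[n]}.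
Local Notation B := {mpoly k[jdim n]}.
Implicit Types (f : P) (g h : B) (s t u : 'I_5) (a b c d : 'I_n) (X Y : Witt k n).

(** The pairing of the covector in slot [t] with [x_s - p]; [etest] is the function [e] of the
    overview. *)
Definition lform s t : B := \sum_a xv t a * (xv s a - xv pt0 a).
Definition etest : B := lform pt1 cov1 * lform pt2 cov2.

(** Remainder of the first-order Taylor expansion of [X a] at [p], evaluated at slot [s]. *)
Definition trem X s a : B :=
  emb s (X a) - emb pt0 (X a) - \sum_c (xv s c - xv pt0 c) * emb pt0 (X a)^`M(c).

(** The motion of the covector cancels the linear Taylor term, so only a remainder of order 2 is
    left; this is why [L] raises the order of [etest]. *)
Lemma hat_lform X s t : (s < 3)%N -> (3 <= t)%N ->
  vact (hat X) (lform s t) = \sum_a xv t a * trem X s a.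
Proof.
move=> s3 t3; have t3' : (t < 3)%N = false by rewrite ltnNge t3.
rewrite /lform vact_sum.
under eq_bigr do rewrite vactM raddfB /= !hat_xv /prol s3 t3' /=.
rewrite big_split /=; under [X in _ = X]eq_bigr do rewrite /trem mulrBr.
rewrite [RHS]sumrB addrC; congr (_ + _).
under eq_bigr do rewrite mulNr; rewrite sumrN; congr (- _).
under eq_bigr do rewrite mulr_suml; rewrite exchange_big /=.
apply: eq_bigr => a _; rewrite mulr_sumr; apply: eq_bigr => c _.
by rewrite -mulrA; congr (_ * _); rewrite mulrC.
Qed.

Lemma neq_pt0 u : (0 < u)%N -> (pt0 == u) = false.
Proof. by move=> u0; apply/eqP => E; move: u0; rewrite -E. Qed.

Lemma pd_trem X u s a c : (0 < u)%N ->
  pd u c (trem X s a) = (s == u)%:R * (emb s (X a)^`M(c) - emb pt0 (X a)^`M(c)).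
Proof.
move=> u0; have Z := neq_pt0 u0.
rewrite /trem !pdB pd_sum !pd_emb Z mul0r subr0.
rewrite (bigD1 c) //= big1 ?addr0.
  rewrite pdM pdB !pd_xv Z pd_emb Z mul0r mulr0 addr0 eqxx andbT /=.
  by rewrite subr0 mulrBr.
move=> d /negPf dc; rewrite pdM pdB !pd_xv Z pd_emb Z dc andbF /= subr0.
by rewrite !mul0r mulr0 addr0.
Qed.

Lemma resN_diff s c : (s < 3)%N -> res None (xv s c - xv pt0 c : B) = 0.
Proof. by move=> s3; rewrite raddfB /= !res_pt // subrr. Qed.

Lemma jetV_lform s t : (0 < s < 3)%N -> jetV None 1 (lform s t).
Proof.
move=> /andP[_ s3]; split=> //; rewrite /lform raddf_sum big1 // => a _.
by rewrite /= rmorphM /= resN_diff // mulr0.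
Qed.

Lemma jetV_trem X s a : (0 < s < 3)%N -> jetV None 2 (trem X s a).
Proof.
move=> /andP[_ s3].
split.
  rewrite /trem !raddfB raddf_sum /= (res_emb _ _ s3) subrr sub0r big1 ?oppr0 // => c _.
  by rewrite /= rmorphM /= resN_diff // mul0r.
move=> u c /andP[u0 u3]; rewrite pd_trem //; split=> //.
by rewrite rmorphM raddfB /= (res_emb _ _ s3) subrr mulr0.
Qed.

Lemma jetV_hat_lform X s t : (0 < s < 3)%N -> (3 <= t)%N ->
  jetV None 2 (vact (hat X) (lform s t)).
Proof.
move=> sP t3; case/andP: (sP) => _ s3; rewrite hat_lform //.
by apply: jetV_sum => a _; apply: jetV_mull; apply: jetV_trem.
Qed.

Lemma jetV_etest : jetV None 2 etest.
Proof. by apply: (jetVM (r1 := 1) (r2 := 1)) => //; apply: jetV_lform. Qed.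

Lemma jetV_hat_etest X : jetV None 3 (vact (hat X) etest).
Proof.
rewrite vactM; apply: jetVD.
  by apply: (jetVM (r1 := 2) (r2 := 1)) => //; [apply: jetV_hat_lform|apply: jetV_lform].
by apply: (jetVM (r1 := 1) (r2 := 2)) => //; [apply: jetV_lform|apply: jetV_hat_lform].
Qed.

Lemma pd_prol X u t c b : (0 < u)%N -> t != u -> pd u c (prol X t b) = 0.
Proof.
move=> u0 /negPf tu; have Z := neq_pt0 u0; rewrite /prol.
case s3: (t < 3)%N; first by rewrite pd_emb tu mul0r.
rewrite raddfN /= pd_sum big1 ?oppr0 // => d _.
by rewrite pdM pd_xv tu pd_emb Z !mul0r mulr0 addr0.
Qed.

Definition indep u g := forall c, pd u c g = 0.

(** Apart from slot [u] itself, no component of [hat X] depends on slot [u > 0], and the components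
    in slot [u] multiply derivatives of [g] that vanish. *)
Lemma indep_hat X u g : (0 < u)%N -> indep u g -> indep u (vact (hat X) g).
Proof.
move=> u0 ug c; rewrite pd_vact ug raddf0 add0r.
rewrite big1 // => t _; rewrite big1 // => b _.
rewrite hat_ix.
by have [->|tu] := eqVneq t u; [rewrite ug mulr0 | rewrite pd_prol ?mul0r].
Qed.

Lemma indep_pd u t a g : indep u g -> indep u (pd t a g).
Proof. by move=> ug c; rewrite pdC ug raddf0. Qed.

Lemma indep_lform u s t : (0 < u)%N -> u != s -> u != t -> indep u (lform s t).
Proof.
move=> u0 us ut c; rewrite /lform pd_sum big1 // => a _.
by rewrite pdM pdB !pd_xv neq_pt0 // ![_ == u]eq_sym (negPf us) (negPf ut) !mul0r subr0 mulr0 addr0.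
Qed.

(** One covector derivative selects a component and two point derivatives differentiate it: [d3]
    kills [lform] and turns [hat X] applied to it into a second derivative of [X a]. *)
Definition d3 s t c d a g : B := pd s c (pd s d (pd t a g)).

Lemma d3_is_linear s t c d a : linear (d3 s t c d a).
Proof. by move=> z g h; rewrite /d3 !linearP. Qed.

HB.instance Definition _ s t c d a :=
  GRing.isLinear.Build k B B _ (d3 s t c d a) (d3_is_linear s t c d a).

Lemma d3_sum s t c d a (I : Type) (r : seq I) (Q : pred I) (F : I -> B) :
  d3 s t c d a (\sum_(x <- r | Q x) F x) = \sum_(x <- r | Q x) d3 s t c d a (F x).
Proof. exact: raddf_sum. Qed.

Lemma d3_indep s t c d a g h : indep s g -> indep t g ->
  d3 s t c d a (g * h) = g * d3 s t c d a h.
Proof.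
move=> sg tg; rewrite /d3 pdM tg mul0r add0r.
by rewrite pdM sg mul0r add0r pdM sg mul0r add0r.
Qed.

Lemma d3_lform s t c d a : (0 < s < 3)%N -> (3 <= t)%N -> d3 s t c d a (lform s t) = 0.
Proof.
move=> sP t3; case/andP: (sP) => s0 s3.
have st : (s == t) = false by apply/eqP => E; move: t3; rewrite -E leqNgt s3.
have t0 : (0 < t)%N by apply: leq_trans t3.
rewrite /d3; have -> : pd t a (lform s t) = xv s a - xv pt0 a.
  rewrite /lform pd_sum (bigD1 a) //= big1 ?addr0.
    rewrite pdM pdB !pd_xv st neq_pt0 // !eqxx /=.
    by rewrite subrr mulr0 addr0 mul1r.
  move=> b /negPf ba; rewrite pdM pdB !pd_xv st neq_pt0 // ba !andbF /=.
  by rewrite subrr mulr0 addr0 mul0r.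
by rewrite pdB !pd_xv neq_pt0 // subr0 -mpolyC_nat pd_const.
Qed.

Lemma d3_hat_lform X s t c d a : (0 < s < 3)%N -> (3 <= t)%N ->
  d3 s t c d a (vact (hat X) (lform s t)) = emb s ((X a)^`M(d)^`M(c)).
Proof.
move=> sP t3; case/andP: (sP) => s0 s3; rewrite hat_lform //.
have st : (s == t) = false by apply/eqP => E; move: t3; rewrite -E leqNgt s3.
have t0 : (0 < t)%N by apply: leq_trans t3.
rewrite /d3 (pd_sum t a) (bigD1 a) //= [X in _ + X]big1 ?addr0.
  rewrite pdM pd_xv !eqxx /= pd_trem // st mul0r mulr0 addr0 mul1r.
  by rewrite pd_trem // eqxx mul1r pdB !pd_emb eqxx mul1r neq_pt0 // mul0r subr0.
move=> b /negPf ba; rewrite pdM pd_xv ba andbF mul0r add0r pd_trem // st mul0r.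
by rewrite mulr0.
Qed.

(** Of the four Leibniz terms of [X Y (A A')], those with both fields on the same factor leave [A]
    or [A'] untouched, and there [d3] gives zero. *)
Lemma d3_hatM X Y A A' c d a c' d' a' :
  indep pt2 A -> indep cov2 A -> indep pt1 A' -> indep cov1 A' ->
  d3 pt1 cov1 c d a A = 0 -> d3 pt2 cov2 c' d' a' A' = 0 ->
  d3 pt1 cov1 c d a (d3 pt2 cov2 c' d' a' (vact (hat X) (vact (hat Y) (A * A')))) =
  d3 pt1 cov1 c d a (vact (hat X) A) * d3 pt2 cov2 c' d' a' (vact (hat Y) A') +
  d3 pt1 cov1 c d a (vact (hat Y) A) * d3 pt2 cov2 c' d' a' (vact (hat X) A').
Proof.
move=> A2 A4 B1 B3 A0 B0.
have TM g h : indep pt2 g -> indep cov2 g -> indep pt1 h -> indep cov1 h ->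
    d3 pt1 cov1 c d a (d3 pt2 cov2 c' d' a' (g * h)) =
    d3 pt1 cov1 c d a g * d3 pt2 cov2 c' d' a' h.
  move=> g2 g4 h1 h3; rewrite (d3_indep _ _ _ _ g2 g4) mulrC d3_indep 1?mulrC //;
  by do 3!apply: indep_pd.
have vD U g h : vact U (g + h) = vact U g + vact U h :> B by exact: raddfD.
have I1 Z g : indep pt1 g -> indep pt1 (vact (hat Z) g) by exact: indep_hat.
have I2 Z g : indep pt2 g -> indep pt2 (vact (hat Z) g) by exact: indep_hat.
have I3 Z g : indep cov1 g -> indep cov1 (vact (hat Z) g) by exact: indep_hat.
have I4 Z g : indep cov2 g -> indep cov2 (vact (hat Z) g) by exact: indep_hat.
rewrite !vactM vD !vactM 3!raddfD 3!raddfD /=.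
rewrite (TM _ _ (I2 X _ (I2 Y _ A2)) (I4 X _ (I4 Y _ A4)) B1 B3).
rewrite (TM _ _ (I2 Y _ A2) (I4 Y _ A4) (I1 X _ B1) (I3 X _ B3)).
rewrite (TM _ _ (I2 X _ A2) (I4 X _ A4) (I1 Y _ B1) (I3 Y _ B3)).
rewrite (TM _ _ A2 A4 (I1 X _ (I1 Y _ B1)) (I3 X _ (I3 Y _ B3))) A0 B0.
by rewrite mulr0 mul0r addr0 add0r addrC.
Qed.

Lemma d3_etest X Y c d a c' d' a' :
  d3 pt1 cov1 c d a (d3 pt2 cov2 c' d' a' (vact (hat X) (vact (hat Y) etest))) =
  emb pt1 ((X a)^`M(d)^`M(c)) * emb pt2 ((Y a')^`M(d')^`M(c')) +
  emb pt1 ((Y a)^`M(d)^`M(c)) * emb pt2 ((X a')^`M(d')^`M(c')).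
Proof.
rewrite /etest d3_hatM; first by rewrite !d3_hat_lform.
- exact: indep_lform.
- exact: indep_lform.
- exact: indep_lform.
- exact: indep_lform.
- exact: d3_lform.
- exact: d3_lform.
Qed.

(** The two cross terms of [d3_etest] have equal sums because [lam] is symmetric, whence the factor
    2. *)
Lemma d3_qact D (X : 'I_D -> Witt k n) (lam : 'M[k]_D) c d a c' d' a' : lam^T = lam ->
  d3 pt1 cov1 c d a (d3 pt2 cov2 c' d' a' (qact X lam etest)) =
  2%:R * qpair lam (jcoef X pt1 a (U_(d) + U_(c))) (jcoef X pt2 a' (U_(d') + U_(c'))).
Proof.
move=> sym; rewrite /qact mulr_natl mulr2n.
have E : qpair lam (jcoef X pt1 a (U_(d) + U_(c))) (jcoef X pt2 a' (U_(d') + U_(c'))) =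
    \sum_i \sum_j lam i j *: (jcoef X pt1 a (U_(d) + U_(c)) j * jcoef X pt2 a' (U_(d') + U_(c')) i).
  rewrite /qpair exchange_big; apply: eq_bigr => i _; apply: eq_bigr => j _.
  by rewrite -[in LHS]sym mxE.
rewrite [X in _ = _ + X]E /qpair -big_split d3_sum d3_sum; apply: eq_bigr => i _ /=.
rewrite -big_split d3_sum d3_sum; apply: eq_bigr => j _ /=.
rewrite !linearZ /= d3_etest scalerDr /jcoef.
by rewrite !mderivmDm !mderivmU1m.
Qed.

End TestFunction.

(** * Propagation of vanishing from a hyperplane along a transverse field *)

Section Transport.
Variables (k : fieldType) (n : nat).
Local Notation P := {mpoly k[n]}.
Local Notation B := {mpoly k[jdim n]}.
Implicit Types (f : P) (g h : B) (s t u : 'I_5) (a b d : 'I_n) (c : k) (X Y : Witt k n).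

(** The bracket of the constant field in direction [a] with [X]. *)
Definition dwitt a X : Witt k n := [ffun b => (X b)^`M(a)].

Lemma transl_prol a X s b : transl a (prol X s b) = prol (dwitt a X) s b.
Proof.
rewrite /prol; case s3: (s < 3)%N; first by rewrite transl_emb // ffunE.
rewrite raddfN raddf_sum /=; congr (- _); apply: eq_bigr => c _ /=.
by rewrite translM transl_xv s3 mul0r add0r transl_emb // ffunE mderiv_comm.
Qed.

Lemma transl_hat a X g :
  transl a (vact (hat X) g) = vact (hat X) (transl a g) + vact (hat (dwitt a X)) g.
Proof.
have E s : pd s a (vact (hat X) g) =
    vact (hat X) (pd s a g) + \sum_t \sum_b pd s a (prol X t b) * pd t b g.
  rewrite pd_vact; congr (_ + _); apply: eq_bigr => t _; apply: eq_bigr => b _.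
  by rewrite hat_ix.
rewrite /transl !E !raddfD /= (vact_hat (dwitt a X)).
have -> : \sum_t \sum_b prol (dwitt a X) t b * pd t b g =
    \sum_t \sum_b pd pt0 a (prol X t b) * pd t b g +
    \sum_t \sum_b pd pt1 a (prol X t b) * pd t b g +
    \sum_t \sum_b pd pt2 a (prol X t b) * pd t b g.
  rewrite -!big_split; apply: eq_bigr => t _; rewrite -!big_split.
  by apply: eq_bigr => b _; rewrite -transl_prol /transl !mulrDl.
by ring.
Qed.

Lemma jetV_tangent r a c Y g : jetV (Some (a, c)) r g ->
  jetV (Some (a, c)) r (vact (hat Y) g - emb pt0 (Y a) * transl a g).
Proof.
(* Components of the lift of [Y] minus [Y a] times the translation: this field is tangent to the
   slice [x_a = c], so [jetV_vact] applies. *)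
pose U s b := prol Y s b - ((s < 3)%N && (b == a))%:R * emb pt0 (Y a).
have -> : vact (hat Y) g - emb pt0 (Y a) * transl a g = vact (vfield U) g.
  rewrite vact_hat vact_vfield; apply/eqP; rewrite subr_eq addrC -subr_eq; apply/eqP.
  rewrite -sumrB; under eq_bigr do rewrite -sumrB.
  rewrite exchange_big (bigD1 a) //= [X in _ + X]big1 ?addr0.
    rewrite (bigID (fun s : 'I_5 => (s < 3)%N)) /= [X in _ + X]big1 ?addr0.
      rewrite (eq_bigr (fun s => emb pt0 (Y a) * pd s a g)).
        by rewrite -mulr_sumr (big_pt (fun s => pd s a g)).
      by move=> s s3; rewrite -mulrBl /U s3 eqxx mul1r subKr.
    by move=> s /negPf s3; rewrite -mulrBl /U s3 mul0r subr0 subrr mul0r.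
  by move=> b /negPf ba; rewrite big1 // => s _; rewrite -mulrBl /U ba andbF mul0r subr0 subrr mul0r.
apply: jetV_vact => [s b s3|b|s b b' sP].
- by rewrite !vfieldE /U s3 !raddfB /= (res_prol _ _ _ s3).
- rewrite /= negbK => /eqP ->; rewrite vfieldE /U eqxx /= mul1r.
  by rewrite /prol /= subrr raddf0.
- rewrite vfieldE /U pdB (pd_prol_pt0 _ _ _ sP) sub0r pdM.
  have s0 : (0 < s)%N by case/andP: sP.
  by rewrite pd_emb neq_pt0 // mul0r mulr0 addr0 -mpolyC_nat pd_const mul0r oppr0.
Qed.

Lemma iter_transl_lin a r z g h : iter r (transl a) (z *: g + h) =
  z *: iter r (transl a) g + iter r (transl a) h.
Proof. by elim: r => //= r ->; rewrite linearP. Qed.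

Lemma iter_translD a r g h : iter r (transl a) (g + h) =
  iter r (transl a) g + iter r (transl a) h.
Proof. by have := iter_transl_lin a r 1 g h; rewrite !scale1r. Qed.

(** Moving a translation past [Y] produces [dwitt a Y] with one translation fewer, so the induction
    on [r] keeps [Y] and [g] general. Modulo order [m] only the top normal derivative survives. *)
Lemma jetV_iter_hat a c m r Y g :
  (forall i, (i <= r)%N -> jetV (Some (a, c)) m (iter i (transl a) g)) ->
  jetV (Some (a, c)) m
    (iter r (transl a) (vact (hat Y) g) - emb pt0 (Y a) * iter r.+1 (transl a) g).
Proof.
elim: r Y g => [|r IH] Y g H; first exact: jetV_tangent (H 0%N isT).
rewrite iterSr transl_hat iter_translD.
have H1 : jetV (Some (a, c)) m (iter r (transl a) (vact (hat (dwitt a Y)) g)).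
  rewrite -[X in jetV _ _ X](subrK (emb pt0 (dwitt a Y a) * iter r.+1 (transl a) g)).
  apply: jetVD; last by apply: jetV_mull; apply: H.
  by apply: IH => i le_i; apply: H; apply: leqW.
have H2 := IH Y (transl a g).
rewrite addrAC; apply: jetVD => //; rewrite [iter r.+2 _ _]iterSr; apply: H2 => i le_i.
by rewrite -iterSr; apply: H.
Qed.

(* If a vector field [Y] transverse to the hyperplane [x_a = c] annihilates [g],
   then the normal derivatives of [g] are determined by its restriction. *)
Lemma jetV_iter_transl a c m Y g : res (Some (a, c)) (emb pt0 (Y a)) != 0 ->
  jetV None m (vact (hat Y) g) -> jetV (Some (a, c)) m g ->
  forall r, jetV (Some (a, c)) m (iter r (transl a) g).
Proof.
move=> Ya VYg Vg r; suff H q : forall i, (i <= q)%N -> jetV (Some (a, c)) m (iter i (transl a) g).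
  exact: (H r r).
elim: q => [|q IH] i; first by rewrite leqn0 => /eqP->.
rewrite leq_eqVlt => /orP[/eqP->|]; last by rewrite ltnS => /IH.
(* Here [Y a] times the next normal derivative equals the [q]-th normal derivative of [Y g] modulo
   order [m]; the latter vanishes because [Y g] does so on the full diagonal. *)
apply: (jetV_cancel Ya); have := jetV_iter_hat Y IH.
set u := iter q _ _; set v := _ * _ => Vuv.
have Vu : jetV (Some (a, c)) m u.
  by apply: jetV_resN; rewrite /u; elim: q {IH u v Vuv} => //= q IH; apply: jetV_transl.
by have := jetVB Vu Vuv; rewrite opprB addrC subrK.
Qed.

Lemma lrmorphism_idE (phi : {lrmorphism B -> P}) : (forall a, phi (xv pt0 a) = 'X_a) ->
  forall f, phi (emb pt0 f) = f.
Proof.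
move=> E; apply: (lrmorphism_ext (phi := phi \o emb pt0) (psi := idfun)) => i /=.
by rewrite embX E.
Qed.

Lemma emb_inj : injective (@emb k n pt0).
Proof.
pose phi : {lrmorphism B -> P} := comp_mpoly [tuple 'X_((ixV i).2) | i < jdim n].
suff K : cancel (@emb k n pt0) phi by apply: can_inj K.
by apply: lrmorphism_idE => a; rewrite /= comp_mpolyXU nth_mktuple ixK.
Qed.

Definition hyp_coord (ac : 'I_n * k) a : P := if a == ac.1 then ac.2%:MP else 'X_a.

Lemma hyp_subproof ac : {phi : {lrmorphism P -> P} | forall a, phi 'X_a = hyp_coord ac a}.
Proof.
exists (comp_mpoly [tuple hyp_coord ac a | a < n]) => a /=.
by rewrite comp_mpolyXU nth_mktuple.
Qed.

Definition hyp ac : {lrmorphism P -> P} := sval (hyp_subproof ac).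

Lemma hypX ac a : hyp ac 'X_a = hyp_coord ac a.
Proof. exact: (svalP (hyp_subproof ac)). Qed.

Lemma res_hyp ac f : res (Some ac) (emb pt0 f) = emb pt0 (hyp ac f).
Proof.
apply: (lrmorphism_ext (phi := res (Some ac) \o emb pt0) (psi := emb pt0 \o hyp ac)) => i.
rewrite /= embX res_pt // hypX /hyp_coord /=.
by case: eqP => _; [rewrite -!alg_mpolyC linearZ /= rmorph1 | rewrite embX].
Qed.

Lemma resN_emb f : res None (emb pt0 f) = emb pt0 f.
Proof.
apply: (lrmorphism_ext (phi := res None \o emb pt0) (psi := emb pt0)) => i /=.
by rewrite embX res_pt.
Qed.

Lemma resN_emb_eq0 f : res None (emb pt0 f) = 0 <-> f = 0.
Proof.
rewrite resN_emb; split=> [|->]; last exact: raddf0.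
by rewrite -(raddf0 (emb pt0)) => /emb_inj.
Qed.

Lemma res_iter_transl a c r g f : res None g = emb pt0 f ->
  res (Some (a, c)) (iter r (transl a) g) =
  emb pt0 (hyp (a, c) (iter r (mderiv a) f)).
Proof.
move=> E; rewrite -res_resN; suff -> : res None (iter r (transl a) g) = emb pt0 (iter r (mderiv a) f).
  exact: res_hyp.
by elim: r => //= r IH; rewrite res_transl // IH pd_emb eqxx mul1r.
Qed.

End Transport.

(** * Restriction to hyperplanes in characteristic zero *)

Section CharZeroPoly.
Variables (k : fieldType) (n : nat).
Hypothesis char0 : [pchar k] =i pred0.
Local Notation P := {mpoly k[n]}.
Implicit Types (f : P) (a b c d : 'I_n) (be ga : 'X_{1..n}).

Lemma natrS_neq0 m : m.+1%:R != 0 :> k.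
Proof. by have [/(_ char0)/(_ m.+1) ->] := pcharf0P k. Qed.

Lemma msupp_mderiv f i m : f^`M(i) = 0 -> m \in msupp f -> m i = 0%N.
Proof.
move=> f0 mf; apply/eqP/negPn/negP => mi.
have := mcoeff_deriv i (m - U_(i))%MM f; rewrite f0 mcoeff0 submK; last first.
  by apply/mnm_lepP => j; rewrite mnm1E; case: eqP => [<-|//]; rewrite lt0n.
move/esym/eqP; rewrite -mulr_natr mulf_eq0 (negPf (natrS_neq0 _)) orbF.
by move: mf; rewrite mcoeff_msupp => /negPf->.
Qed.

Lemma msize_mderiv f i : (msize f^`M(i) <= (msize f).-1)%N.
Proof.
rewrite msizeE; apply/bigmax_leqP_seq => m mf _.
have : (m + U_(i))%MM \in msupp f.
  move: mf; rewrite !mcoeff_msupp mcoeff_deriv; apply: contraNN => /eqP->.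
  by rewrite mul0rn.
by move/msize_mdeg_lt; rewrite mdegD mdeg1; case: (msize f) => // q; rewrite addn1.
Qed.

Lemma mderiv_const f : (forall i, f^`M(i) = 0) -> f = (f@_0)%:MP.
Proof.
move=> f0; apply/mpolyP => m; rewrite mcoeffC; case: (eqVneq m 0%MM) => [->|m0].
  by rewrite mulr1.
rewrite mulr0; apply/eqP; rewrite mcoeff_eq0; apply/negP => mf; case/eqP: m0.
by apply/mnmP => i; rewrite mnm0E; apply: msupp_mderiv mf.
Qed.

Lemma hyp_id ac f : f^`M(ac.1) = 0 -> hyp ac f = f.
Proof.
move=> f0; rewrite {2}(mpolyE f) {1}(mpolyE f) raddf_sum; apply: eq_big_seq => m mf /=.
rewrite linearZ /= mpolyXE_id rmorph_prod; congr (_ *: _); apply: eq_bigr => i _ /=.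
rewrite rmorphXn /= hypX /hyp_coord; case: eqP => [->|//].
by rewrite (msupp_mderiv f0 mf) !expr0.
Qed.

(** The derivative of [f] satisfies the same hypothesis in lower degree, so it is zero; then [f]
    does not involve the variable and equals its restriction. *)
Lemma hyp_iter_eq0 ac f : (forall r, hyp ac (iter r (mderiv ac.1) f) = 0) -> f = 0.
Proof.
have [m le_m] := ubnP (msize f); elim: m f le_m => // m IH f le_m H.
have f0 : f^`M(ac.1) = 0.
  have [->|nf] := eqVneq f 0; first exact: mderiv0.
  apply: IH => [|r]; last by rewrite -iterSr; apply: H.
  apply: leq_ltn_trans (msize_mderiv _ _) _.
  by move: le_m nf; rewrite -msize_poly_eq0; case: (msize f).
by have := H 0%N; rewrite /= hyp_id.
Qed.

Lemma rmorphism_ext (S : comNzRingType) (phi psi : {rmorphism P -> S}) :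
  (forall z, phi z%:MP = psi z%:MP) -> (forall i, phi 'X_i = psi 'X_i) -> phi =1 psi.
Proof.
move=> EC E f; rewrite (mpolyE f) !rmorph_sum; apply: eq_bigr => m _ /=.
rewrite -mul_mpolyC !rmorphM EC; congr (_ * _); rewrite mpolyXE_id !rmorph_prod.
by apply: eq_bigr => i _; rewrite !rmorphXn /= E.
Qed.

(** View [f] as a polynomial in [x_a] over [P]. If all restrictions vanished, every integer would be
    a root, too many for a nonzero polynomial over a domain. *)
Lemma exists_hyp_neq0 a f : f != 0 -> exists z, hyp (a, z) f != 0.
Proof.
move=> nf; apply: contrapT => /forallNP H.
have {}H z : hyp (a, z) f = 0 by apply/eqP/negPn/negP/H.
pose h i : {poly P} := if i == a then 'X else ('X_i)%:P.
pose psi : {rmorphism P -> {poly P}} := mmap (polyC \o @mpolyC n k) h.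
have psiC z : psi z%:MP = z%:MP%:P by rewrite /psi /= mmapC.
have psiX i : psi 'X_i = h i by rewrite /psi /= mmapX mmap1U.
have ev x : (forall i, (h i).[x] = if i == a then x else 'X_i).
  by move=> i; rewrite /h; case: eqP => _; rewrite ?hornerX ?hornerC.
have E z : (psi f).[z%:MP] = hyp (a, z) f.
  apply: (rmorphism_ext (phi := horner_eval z%:MP \o psi) (psi := hyp (a, z))) => [y|i] /=.
    by rewrite psiC /horner_eval hornerC -alg_mpolyC linearZ /= rmorph1.
  by rewrite psiX /horner_eval ev hypX.
have Ef : (psi f).['X_a] = f.
  apply: (rmorphism_ext (phi := horner_eval 'X_a \o psi) (psi := idfun)) => [y|i] /=.
    by rewrite psiC /horner_eval hornerC.
  by rewrite psiX /horner_eval ev; case: eqP => [->|].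
have npsi : psi f != 0 by apply: contra_neq nf => p0; rewrite -Ef p0 horner0.
pose s := [seq (i%:R : k)%:MP_[n] | i <- iota 0 (size (psi f))].
have : (size s < size (psi f))%N.
  apply: max_poly_roots => //.
    by apply/allP => _ /mapP[i _ ->]; rewrite /root E H.
  rewrite map_inj_uniq ?iota_uniq // => i j /eqP; rewrite mpolyC_eq.
  wlog le_ij : i j / (i <= j)%N.
    by move=> W ij; case: (leqP i j) => [/W->//|/ltnW/W->//]; rewrite eq_sym.
  rewrite eq_sym -subr_eq0 -natrB //; case D: (j - i)%N => [|q]; last by rewrite (negPf (natrS_neq0 q)).
  by move=> _; apply/eqP; rewrite eqn_leq le_ij -subn_eq0 D.
by rewrite size_map size_iota ltnn.
Qed.

Lemma mnm_split ga m : mdeg ga = m.+1 ->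
  exists ga' c, ga = (ga' + U_(c))%MM /\ mdeg ga' = m.
Proof.
move=> dg; have [c gc] : exists c, (0 < ga c)%N.
  apply: contrapT => /forallNP H; move: dg; rewrite mdegE big1 // => c _.
  by apply/eqP; rewrite -leqn0 leqNgt; apply/negP/H.
exists (ga - U_(c))%MM, c; have E : (ga - U_(c) + U_(c))%MM = ga.
  by apply: submK; apply/mnm_lepP => j; rewrite mnm1E; case: eqP => [<-|].
by split=> //; apply/eqP; rewrite -eqSS -dg -{2}E mdegD mdeg1 addn1.
Qed.

End CharZeroPoly.

(** * From order [j] to order [j + 1] *)

Section Step.
Variables (k : fieldType) (n D : nat) (X : 'I_D -> Witt k n).
Hypothesis char0 : [pchar k] =i pred0.
Local Notation P := {mpoly k[n]}.
Local Notation B := {mpoly k[jdim n]}.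
Implicit Types (f : P) (a b c d : 'I_n) (be ga : 'X_{1..n}) (lam : 'M[k]_D).

Lemma mderiv_Psi lam a b be ga c : (Psi X lam a b be ga)^`M(c) =
  Psi X lam a b (be + U_(c)) ga + Psi X lam a b be (ga + U_(c)).
Proof.
rewrite /Psi mderiv_sum -big_split; apply: eq_bigr => i _ /=.
rewrite mderiv_sum -big_split; apply: eq_bigr => j _ /=.
by rewrite mderivZ mderivM scalerDr !mderivm_U.
Qed.

Lemma vanishN J lam : vanish X None J lam <->
  forall a b be ga, (mdeg be + mdeg ga < J)%N -> Psi X lam a b be ga = 0.
Proof.
by split=> H a b be ga lt_J; apply/resN_emb_eq0; apply: H.
Qed.

(** Differentiating a vanishing jet of order [J - 1] along the diagonal shows that one derivative
    can pass from the first factor to the second at the cost of a sign. *)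
Lemma Psi_shift J lam a b be ga : vanish X None J lam -> (mdeg be + mdeg ga = J)%N ->
  Psi X lam a b be ga = (-1) ^+ mdeg be *: Psi X lam a b 0 (be + ga).
Proof.
move/vanishN => H; move E : (mdeg be) => m; elim: m be ga E => [|m IH] be ga.
  by move/eqP; rewrite mdeg_eq0 => /eqP -> _; rewrite expr0 scale1r add0m.
move=> /mnm_split [be' [c [-> db]]] dJ.
have := H a b be' ga; rewrite db => /(_ _)/(congr1 (mderiv c)).
rewrite mderiv_Psi mderiv0 => /(_ _)/eqP; rewrite addr_eq0 => Heq.
rewrite (eqP (Heq _)); last by lia.
rewrite (IH be' (ga + U_(c))%MM) //; last by rewrite mdegD mdeg1; lia.
by rewrite exprS mulN1r scaleNr -addmA [(ga + _)%MM]addmC.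
Qed.

Lemma pd_iter_transl r a s b (g : B) :
  pd s b (iter r (transl a) g) = iter r (transl a) (pd s b g).
Proof. by elim: r => //= r IH; rewrite -transl_pd IH. Qed.

Lemma vanish_step lam j a z (Y : Witt k n) : lam^T = lam -> (4 <= j)%N -> vanish X None j lam ->
  (forall a' b ga, mdeg ga = j -> hyp (a, z) (Psi X lam a' b 0 ga) = 0) ->
  hyp (a, z) (Y a) != 0 ->
  jetV None j.+1 (vact (hat Y) (qact X lam (etest k n))) ->
  vanish X None j.+1 lam.
Proof.
move=> sym j4 van Hhyp Ya VY; set o := Some (a, z).
(* By [Psi_shift] the hypothesis on jets with [be = 0] covers all jets of order [j] on the
   hyperplane. *)
have vano : vanish X o j.+1 lam.
  move=> a' b be ga; rewrite ltnS leq_eqVlt => /orP[/eqP dj|lt_j].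
    by rewrite res_hyp (Psi_shift _ _ van dj) linearZ /= Hhyp ?scaler0 ?raddf0 // mdegD.
  by rewrite -res_resN van // raddf0.
have VG : jetV o j.+1 (qact X lam (etest k n)).
  by apply: (jetV_qact vano (jetV_etest k n)).
have Ya' : res o (emb pt0 (Y a)) != 0.
  by rewrite res_hyp -(raddf0 (emb pt0)) (inj_eq (@emb_inj k n)).
have VT := jetV_iter_transl Ya' VY VG.
have two : 2%:R != 0 :> k by apply: natrS_neq0.
(* The two [d3] use four derivatives in [q], [q'] and differentiate both factors twice; each further
   derivative in [q'] falls on the second factor only and costs one order. *)
have Q r a1 a2 c d ga m : mdeg ga = m.+2 ->
    jetV o (j - 3 - m) (iter r (transl a)
      (qpair lam (jcoef X pt1 a1 (U_(d) + U_(c))) (jcoef X pt2 a2 ga))).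
  elim: m ga => [|m IH] ga dg.
    have [ga1 [c' [-> /mnm_split [ga2 [d' [-> dg2]]]]]] := mnm_split dg.
    move/eqP: dg2; rewrite mdeg_eq0 => /eqP ->; rewrite add0m subn0.
    set q := qpair _ _ _.
    have : jetV o (j.+1).-1.-1.-1.-1
        (d3 pt1 cov1 c d a1 (d3 pt2 cov2 c' d' a2 (iter r (transl a) (qact X lam (etest k n))))).
      rewrite /d3; do 2!(apply: jetV_pd => //); apply: jetV_pd_cov => //.
      by do 2!(apply: jetV_pd => //); apply: jetV_pd_cov => //; apply: VT.
    rewrite /d3 !pd_iter_transl -/(d3 pt2 cov2 c' d' a2 _) -/(d3 pt1 cov1 c d a1 _).
    rewrite d3_qact // -/q mulr_natl -scaler_nat => /(jetVZ 2%:R^-1).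
    have -> : (2%:R^-1 : k) *: iter r (transl a) (2%:R *: q) = iter r (transl a) q.
      have := iter_transl_lin a r 2%:R q 0; rewrite !addr0 => ->.
      have -> : iter r (transl a) 0 = 0 :> B by elim: r => //= ? ->; rewrite raddf0.
      by rewrite addr0 scalerA mulVf // scale1r.
    by apply: jetV_le; lia.
  have [ga' [c' [-> dg']]] := mnm_split dg.
  have := jetV_pd (s := pt2) c' isT (IH ga' dg').
  rewrite pd_iter_transl pd_qpair (eq_qpair _ (pd_jcoef _ _ _ _ _ _) (frefl _)) qpairMl mul0r add0r.
  rewrite (eq_qpair _ (frefl _) (pd_jcoef _ _ _ _ _ _)) qpairMr eqxx mul1r.
  by apply: jetV_le; lia.
(* With [m = j - 4] one order is left: all normal derivatives of this jet of order [j] vanish on the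
   hyperplane, so the jet is zero. *)
have P2 a1 a2 c d ga : (mdeg ga + 2 = j)%N -> Psi X lam a1 a2 (U_(d) + U_(c)) ga = 0.
  move=> dg; apply: (hyp_iter_eq0 char0 (ac := (a, z))) => r.
  have Hm : mdeg ga = (j - 4).+2 by lia.
  have := Q r a1 a2 c d ga _ Hm; rewrite (_ : j - 3 - (j - 4) = 1)%N; last by lia.
  case=> + _; rewrite (@res_iter_transl _ _ a z r _ (Psi X lam a1 a2 (U_(d) + U_(c)) ga)).
    by rewrite -(raddf0 (emb pt0)) => /emb_inj.
  by rewrite res_qpair // resN_emb.
apply/vanishN => a1 a2 be ga; rewrite ltnS leq_eqVlt => /orP[/eqP dj|lt_j]; last first.
  by move/vanishN: van; apply.
(* Any splitting of the [j] derivatives reduces, up to sign, to the splitting into [2] and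
   [j - 2]. *)
rewrite (Psi_shift _ _ van dj); set ga0 := (be + ga)%MM.
have : mdeg ga0 = j by rewrite mdegD.
move: j4; case: (j) van P2 => [//|[//|j']] van P2 _ /mnm_split[ga1 [c [-> /mnm_split[ga2 [d [-> dg2]]]]]].
have := P2 a1 a2 c d ga2; rewrite dg2 addn2 => /(_ erefl).
rewrite (Psi_shift _ _ van); last by rewrite mdegD !mdeg1 dg2.
rewrite mdegD !mdeg1 expr2 mulN1r opprK scale1r => E.
by rewrite -addmA addmC E scaler0.
Qed.

End Step.

(** * Linear algebra *)

Section LinearAlgebra.
Variable k : fieldType.

Lemma lin_system (I T : finType) (f : I -> T -> k) : (#|I| < #|T|)%N ->
  exists mu : T -> k, (exists t, mu t != 0) /\ forall i, \sum_t mu t * f i t = 0.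
Proof.
move=> lt_IT; pose A := \matrix_(t < #|T|, i < #|I|) f (enum_val i) (enum_val t).
have : kermx A != 0.
  rewrite kermx_eq0 -row_leq_rank -ltnNge; apply: leq_ltn_trans lt_IT.
  exact: rank_leq_col.
case/rowV0Pn => v /sub_kermxP vA v0; exists (fun t => v 0 (enum_rank t)); split.
  case/rV0Pn: v0 => j vj; exists (enum_val j); by rewrite enum_valK.
move=> i; move/rowP/(_ (enum_rank i)): vA; rewrite !mxE => vA.
rewrite -[RHS]vA.
rewrite [RHS](reindex_onto (@enum_rank T) enum_val) /=; last by move=> ? _; rewrite enum_valK.
apply: eq_big => [t|t _]; first by rewrite enum_rankK eqxx.
by rewrite mxE !enum_rankK.
Qed.

(** Among the subspaces contained in [Q], one of largest dimension is all of [Q]; otherwise a line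
    could be added. *)
Lemma subspace_vspace (vT : vectType k) (Q : vT -> Prop) : Q 0 ->
  (forall z u v, Q u -> Q v -> Q (z *: u + v)) ->
  exists U : {vspace vT}, forall v, v \in U <-> Q v.
Proof.
move=> Q0 QL; pose R d := `[< exists U : {vspace vT}, \dim U = d /\ forall v, v \in U -> Q v >].
have R0 : exists d, R d.
  exists 0%N; apply/asboolP; exists 0%VS; split; first exact: dimv0.
  by move=> v; rewrite memv0 => /eqP->.
have Rub d : R d -> (d <= \dim {:vT})%N.
  by move=> /asboolP[U [<- _]]; apply: dimvS; apply: subvf.
case: (ex_maxnP R0 Rub) => d /asboolP[U [dU UQ]] max_d; exists U => v; split; first exact: UQ.
move=> Qv; apply/negPn/negP => vU.
have : R (\dim (U + <[v]>)%VS).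
  apply/asboolP; exists (U + <[v]>)%VS; split=> // w /memv_addP[u uU [w' /vlineP[z ->] ->]].
  by rewrite addrC; apply: QL => //; apply: UQ.
move/max_d; rewrite -dU (geq_leqif (dimv_leqif_sup (addvSl U <[v]>))) => le_U.
case/negP: vU; move/subvP: le_U; apply.
by rewrite -[X in X \in _]add0r memv_add ?mem0v ?memv_line.
Qed.

End LinearAlgebra.

(** * The action of the enveloping algebra and the use of noetherianity *)

Lemma vact_linl (k : fieldType) (N : nat) (z : k) (U V : Witt k N) g :
  vact (z *: U + V) g = z *: vact U g + vact V g.
Proof.
rewrite !vactE scaler_sumr -big_split; apply: eq_bigr => i _ /=.
by rewrite wittP mulrDl scalerAl.
Qed.

Definition wact (k : fieldType) (n : nat) (L : {pred Witt k n})
    (w : monalg.fmonom (Lelt L)) (g : {mpoly k[jdim n]}) : {mpoly k[jdim n]} :=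
  foldr (fun X h => vact (hat (val X)) h) g (monalg.fmonom_val w).

HB.lock Definition ract (k : fieldType) (n : nat) (L : {pred Witt k n})
    (x : freeAlg L) (g : {mpoly k[jdim n]}) : {mpoly k[jdim n]} :=
  monalg.mmap (@mpolyC (jdim n) k) (fun w => wact w g) x.

Section FreeAlgebraAction.
Variables (k : fieldType) (n : nat) (L : {pred Witt k n}).
Local Notation B := {mpoly k[jdim n]}.
Local Notation A := (freeAlg L).
Implicit Types (x y : A) (g h : B) (w : monalg.fmonom (Lelt L)).

Lemma wact_lin w z g h : wact w (z *: g + h) = z *: wact w g + wact w h.
Proof.
rewrite /wact; case: w => w /=; elim: w => //= X w ->; exact: linearP.
Qed.

Lemma ractE x g : ract x g = \sum_(w <- finmap.enum_fset (monalg.msupp x)) monalg.mcoeff w x *: wact w g.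
Proof. by rewrite unlock; apply: eq_bigr => w _; rewrite mul_mpolyC. Qed.

Lemma ract0 g : ract (0 : A) g = 0.
Proof. by rewrite unlock; apply: monalg.mmap0. Qed.

Lemma ractD x y g : ract (x + y) g = ract x g + ract y g.
Proof. by rewrite unlock; apply: monalg.mmapD. Qed.

Lemma ractB x y g : ract (x - y) g = ract x g - ract y g.
Proof. by rewrite unlock; apply: monalg.mmapB. Qed.

Lemma ract_sum (I : Type) (r : seq I) (Q : pred I) (F : I -> A) g :
  ract (\sum_(i <- r | Q i) F i) g = \sum_(i <- r | Q i) ract (F i) g.
Proof. exact: (big_morph (fun x : A => ract x g) (fun x y : A => ractD x y g) (ract0 g)). Qed.

Lemma ract_mon z w g : ract (monalg.mkmalgU w z) g = z *: wact w g.
Proof. by rewrite unlock monalg.mmapU mul_mpolyC. Qed.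

Lemma ract_lin x z g h : ract x (z *: g + h) = z *: ract x g + ract x h.
Proof.
rewrite !ractE scaler_sumr -big_split; apply: eq_bigr => w _ /=.
by rewrite wact_lin scalerDr !scalerA mulrC.
Qed.

Lemma ract_r0 x : ract x 0 = 0.
Proof.
by have := ract_lin x (-1) 0 0; rewrite scaler0 addr0 scaleN1r addNr.
Qed.

Lemma ractM x y g : ract (x * y) g = ract x (ract y g).
Proof.
rewrite monalg.malgME ract_sum [RHS]ractE; apply: eq_bigr => u _.
rewrite ract_sum; transitivity (\sum_(v <- finmap.enum_fset (monalg.msupp y))
    monalg.mcoeff u x *: wact u (monalg.mcoeff v y *: wact v g)).
  apply: eq_bigr => v _; rewrite ract_mon.
  have := wact_lin u (monalg.mcoeff v y) (wact v g) 0.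
  have -> : wact u 0 = 0.
    by have := wact_lin u (-1) 0 0; rewrite scaler0 addr0 scaleN1r addNr.
  rewrite !addr0 => ->; rewrite scalerA; congr (_ *: _).
  by rewrite /wact /= monalg.fmM foldr_cat.
rewrite -scaler_sumr (ractE y); congr (_ *: _).
elim: (finmap.enum_fset (monalg.msupp y)) => [|v r IH]; rewrite ?big_nil ?big_cons.
  by have := wact_lin u (-1) 0 0; rewrite scaler0 addr0 scaleN1r addNr.
have := wact_lin u 1 (monalg.mcoeff v y *: wact v g); rewrite !scale1r => -> .
by rewrite IH.
Qed.

Lemma ractZ z x g : ract (z *: x) g = z *: ract x g.
Proof. by rewrite -monalg.mul_malgC ractM ract_mon /wact /= monalg.fm1. Qed.

Lemma ract_letter (X : Lelt L) g : ract (letter X) g = vact (hat (val X)) g.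
Proof. by rewrite /letter ract_mon scale1r /wact monalg.fmU. Qed.

Lemma ract_comm x y z g :
  ract (x * y - y * x - z) g = ract x (ract y g) - ract y (ract x g) - ract z g.
Proof. by rewrite !ractB !ractM. Qed.

(** Since [hat] is linear and respects brackets, the relations act by zero: the action factors
    through [U(L)]. *)
Lemma ract_ideal x g : UL_ideal x -> ract x g = 0.
Proof.
case=> m [c [y [Hy ->]]]; rewrite ract_sum big1 // => i _; rewrite ractZ.
have [a [r [b [Hr ->]]]] := Hy i; rewrite !ractM.
suff -> : ract r (ract b g) = 0 by rewrite ract_r0 scaler0.
case: Hr => [[z [X [Y [Z [E ->]]]]]|[X [Y [Z [E ->]]]]].
  by rewrite ractB ractD ractZ !ract_letter E hat_lin vact_linl subrr.
by rewrite ract_comm !ract_letter E hat_bracket vact_bracket subrr.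
Qed.

Lemma jetV_ract r x g : jetV None r g -> jetV None r (ract x g).
Proof.
move=> Vg; rewrite ractE; apply: jetV_sum => w _; apply: jetVZ; rewrite /wact.
by case: w => w /=; elim: w => //= X w IH; apply: jetV_hat.
Qed.

(** A nonempty word sends [etest] to order 3, so modulo order 3 only the constant term of [x]
    acts. *)
Lemma ract_etest x : exists z v, ract x (etest k n) = z *: etest k n + v /\ jetV None 3 v.
Proof.
rewrite ractE; apply: (big_ind (fun g => exists z v, g = z *: etest k n + v /\ jetV None 3 v)).
- by exists 0, 0; rewrite scale0r addr0; split=> //; apply: jetV0.
- move=> _ _ [z1 [v1 [-> V1]]] [z2 [v2 [-> V2]]]; exists (z1 + z2), (v1 + v2).
  by rewrite scalerDl addrACA; split=> //; apply: jetVD.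
move=> w _; case: w => -[|X w]; set c := monalg.mcoeff _ _.
  by exists c, 0; rewrite addr0; split=> //; apply: jetV0.
exists 0; eexists; split; first by rewrite scale0r add0r; reflexivity.
apply: jetVZ; rewrite /wact {c}; elim: w X => [|Y w IH] X; first exact: jetV_hat_etest.
exact: jetV_hat (IH Y).
Qed.

Definition annV j x := forall g, jetV None 3 g -> jetV None j (ract x g).

(** The sets [I m], graded by the degree of a representative of [x e] modulo order [j], are right
    ideals: [x y e] is a scalar multiple of [x e] modulo order [j] by [ract_etest]. Once the chain
    is stationary, one degree bound serves every [x]. *)
Lemma noeth_bound j : quot_right_noetherian (@UL_ideal _ _ L) ->
  exists N, forall x, annV j x ->
    exists h, (msize h <= N)%N /\ jetV None j (ract x (etest k n) - h).
Proof.
pose I m : A -> Prop := fun x => annV j x /\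
  exists h, (msize h <= m)%N /\ jetV None j (ract x (etest k n) - h).
move=> /(_ I) [|N HN].
  move=> m; split; last split.
  - split.
    + split=> [g _|]; first by rewrite ract0; apply: jetV0.
      by exists 0; rewrite msize0 ract0 subrr; split=> //; apply: jetV0.
    + move=> x y [ax [hx [sx Vx]]] [ay [hy [sy Vy]]]; split.
        by move=> g Vg; rewrite ractD; apply: jetVD; [apply: ax | apply: ay].
      exists (hx + hy); split; last first.
        by rewrite ractD opprD addrACA; apply: jetVD.
      by apply: leq_trans (msizeD_le _ _) _; rewrite geq_max sx sy.
    + move=> y x [ax [hx [sx Vx]]]; split.
        by move=> g Vg; rewrite ractM; apply: ax; apply: jetV_ract.
      have [z [v [E Vv]]] := ract_etest y; exists (z *: hx); split.
        exact: leq_trans (msizeZ_le _ _) sx.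
      rewrite ractM E ract_lin addrAC -scalerBr; apply: jetVD; last exact: ax.
      exact: jetVZ.
  - move=> x Jx; split=> [g _|]; first by rewrite ract_ideal //; apply: jetV0.
    by exists 0; rewrite msize0 ract_ideal // subrr; split=> //; apply: jetV0.
  - by move=> x [ax [h [sh Vh]]]; split=> //; exists h; split=> //; apply: leqW.
exists N => x ax; pose M := maxn N (msize (ract x (etest k n))).
have IM : I M x.
  split=> //; exists (ract x (etest k n)); split; first exact: leq_maxr.
  by rewrite subrr; apply: jetV0.
by move: IM; rewrite (HN M (leq_maxl _ _)) => -[].
Qed.

End FreeAlgebraAction.

(** * Linear families, degrees and independence *)

Section LinearFamilies.
Variable k : fieldType.

Lemma lin_comb (V W : lmodType k) (F : V -> W) (I : Type) (r : seq I) (c : I -> k) (Z : I -> V) :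
  linear F -> F (\sum_(i <- r) c i *: Z i) = \sum_(i <- r) c i *: F (Z i).
Proof.
move=> FL; elim: r => [|i r IH]; last by rewrite !big_cons FL IH.
by rewrite !big_nil; have := FL (-1) 0 0; rewrite scaler0 addr0 scaleN1r addNr.
Qed.

Definition findep (V : lmodType k) q (Z : 'I_q -> V) :=
  forall c : 'I_q -> k, \sum_i c i *: Z i = 0 -> forall i, c i = 0.

End LinearFamilies.

Section Degree.
Variables (k : fieldType) (n : nat).
Hypothesis char0 : [pchar k] =i pred0.
Local Notation P := {mpoly k[n]}.
Implicit Types (f g : P) (a b c : 'I_n) (be ga : 'X_{1..n}) (d e : nat).

(** Degree at most [d]: [msize] is the degree plus one, and 0 for the zero polynomial. *)
Definition dle d f := (msize f <= d.+1)%N.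

Lemma dleM d e f g : dle d f -> dle e g -> dle (d + e)%N (f * g).
Proof.
rewrite /dle => df dg; have [->|f0] := eqVneq f 0; first by rewrite mul0r msize0.
have [->|g0] := eqVneq g 0; first by rewrite mulr0 msize0.
by rewrite msizeM //; move: df dg; move: (msize f) (msize g) => x y; lia.
Qed.

Lemma dleZ d z f : dle d f -> dle d (z *: f).
Proof. exact: leq_trans (msizeZ_le _ _). Qed.

Lemma dle_sum d (I : Type) (r : seq I) (Q : pred I) (F : I -> P) :
  (forall i, Q i -> dle d (F i)) -> dle d (\sum_(i <- r | Q i) F i).
Proof.
move=> H; apply: (big_ind (fun f => dle d f)) => // [|f g df dg]; first by rewrite /dle msize0.
by rewrite /dle; apply: (leq_trans (msizeD_le f g)); rewrite geq_max; apply/andP.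
Qed.

Lemma msize_mderivm ga f : (msize f^`M[ga] <= msize f - mdeg ga)%N.
Proof.
move E : (mdeg ga) => m; elim: m ga E => [|m IH] ga.
  by move/eqP; rewrite mdeg_eq0 => /eqP->; rewrite mderivm0m subn0.
move=> /mnm_split[ga' [c [-> dg]]]; rewrite -mderivm_U.
apply: leq_trans (msize_mderiv _ _) _; move: (IH _ dg).
by move: (msize _) (msize _) => x y; lia.
Qed.

Lemma hyp_dle ac d f : dle d f -> dle d (hyp ac f).
Proof.
move=> df; rewrite [f]mpolyE raddf_sum big_seq; apply: dle_sum => m mf.
rewrite /= linearZ /=; apply: dleZ; apply: leq_trans (leq_trans (msize_mdeg_lt mf) df).
rewrite -/(dle (mdeg m) _) mpolyXE_id rmorph_prod mdegE.
elim/big_ind2: _ => [|d1 f1 d2 f2|i _]; first by rewrite /dle msize1.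
  exact: dleM.
rewrite rmorphXn /= hypX; elim: (m i) => [|l IH]; first by rewrite /dle expr0 msize1.
rewrite exprS -add1n; apply: dleM => //; rewrite /hyp_coord /dle.
by case: eqP => _; [rewrite msizeC; case: (_ != _) | rewrite msizeX mdeg1].
Qed.

Lemma mderiv_hyp ac f : (hyp ac f)^`M(ac.1) = 0.
Proof.
apply: (derivation_ext (phi := hyp ac) (D := fun f => (hyp ac f)^`M(ac.1))) f => [z f g|f g|i].
- by rewrite linearP /= mderivD mderivZ.
- by rewrite rmorphM /= mderivM.
by rewrite hypX /hyp_coord; case: eqP => [_|/eqP/negPf ia]; rewrite ?mderivC // mderivU ia.
Qed.

Lemma mnm_le_mdeg (m : 'X_{1..n}) i : (m i <= mdeg m)%N.
Proof. by rewrite mdegE (bigD1 i) //= leq_addr. Qed.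

(** Differentiating the relations gives the same relations for the derivatives of the [h j], which
    vanish by induction on the degree. So the [h j] are constants, and independence of [X]
    applies. *)
Lemma independent_relation D (X : 'I_D -> Witt k n) (h : 'I_D -> P) : findep X ->
  (forall b ga, \sum_j h j * (X j b)^`M[ga] = 0) -> forall j, h j = 0.
Proof.
move=> indX; have [m] : exists m, forall j, (msize (h j) <= m)%N.
  by exists (\max_j msize (h j))%N => j; apply: (@leq_bigmax _ (fun j => msize (h j))).
elim: m h => [|m IH] h hm rel.
  by move=> j; apply/eqP; rewrite -msize_poly_eq0 -leqn0.
have dh c j : (h j)^`M(c) = 0.
  apply: (IH (fun j => (h j)^`M(c))) => [i|b ga].
    apply: leq_trans (msize_mderiv _ _) _; move: (hm i).
    by move: (msize _) => x; lia.
  have := congr1 (mderiv c) (rel b ga); rewrite mderiv0 mderiv_sum.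
  under eq_bigr do rewrite mderivM mderivm_U.
  by rewrite big_split /= rel addr0.
have hC j : h j = ((h j)@_0)%:MP by apply: mderiv_const.
have H0 : \sum_j (h j)@_0 *: X j = 0.
  apply/ffunP => b; rewrite sum_ffunE [RHS]ffunE -[RHS](rel b 0%MM); apply: eq_bigr => j _.
  by rewrite ffunE {2}(hC j) mul_mpolyC mderivm0m.
by move=> j; rewrite hC (indX _ H0) mpolyC0.
Qed.

End Degree.

(** * Linearity in the coefficient matrix *)

Section QuadLinear.
Variables (k : fieldType) (n D : nat) (X : 'I_D -> Witt k n).
Implicit Types (lam mu : 'M[k]_D).

Lemma Psi_lin z lam mu a b be ga : Psi X (z *: lam + mu) a b be ga =
  z *: Psi X lam a b be ga + Psi X mu a b be ga.
Proof.
rewrite /Psi scaler_sumr -big_split; apply: eq_bigr => i _ /=.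
rewrite scaler_sumr -big_split; apply: eq_bigr => j _ /=.
by rewrite !mxE scalerDl scalerA.
Qed.

Lemma qact_lin z lam mu g : qact X (z *: lam + mu) g = z *: qact X lam g + qact X mu g.
Proof.
rewrite /qact scaler_sumr -big_split; apply: eq_bigr => i _ /=.
rewrite scaler_sumr -big_split; apply: eq_bigr => j _ /=.
by rewrite !mxE scalerDl scalerA.
Qed.

Lemma vanish_lin J z lam mu : vanish X None J lam -> vanish X None J mu ->
  vanish X None J (z *: lam + mu).
Proof.
move=> /vanishN H1 /vanishN H2; apply/vanishN => a b be ga lt_J.
by rewrite Psi_lin H1 // H2 // scaler0 addr0.
Qed.

End QuadLinear.

(** * An element of [L] killing the jets, and the resulting hyperplane *)

Section Annihilator.
Variables (k : fieldType) (n : nat) (L : {pred Witt k n}).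
Hypothesis char0 : [pchar k] =i pred0.
Hypothesis Lsub : is_Lie_subalgebra L.
Hypothesis noeth : quot_right_noetherian (@UL_ideal _ _ L).
Hypothesis Linf : forall q, exists Z : 'I_q -> Witt k n, (forall i, Z i \in L) /\ findep Z.
Local Notation A := (freeAlg L).
Local Notation B := {mpoly k[jdim n]}.
Local Notation e := (etest k n).

Lemma mem_lincomb q (Z : 'I_q -> Witt k n) (c : 'I_q -> k) :
  (forall i, Z i \in L) -> \sum_i c i *: Z i \in L.
Proof.
case: Lsub => L0 LD LZ _ ZL; apply: (big_ind (fun Y => Y \in L)) => // i _; exact: LZ.
Qed.

Lemma vact_hat_linl (g : B) : linear (fun Y : Witt k n => vact (hat Y) g).
Proof. by move=> z Y Z; rewrite hat_lin vact_linl. Qed.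

(* [ract (annV j) e] is an [L]-submodule of bounded degree modulo [jetV None j],
   so some nonzero element of [L] annihilates any finite part of it. *)
Lemma exists_killer j r (x : 'I_r -> A) : (forall i, annV j (x i)) ->
  exists Y, [/\ Y \in L, Y != 0 & forall i, jetV None j (vact (hat Y) (ract (x i) e))].
Proof.
move=> ax; have [N HN] := noeth_bound j noeth.
(* [T] lists the coefficients of [r] polynomials with [msize] at most [N]; one more independent
   field than that leaves a nontrivial combination cancelling them all. *)
pose T : finType := ('I_r * bmultinom (jdim n) N)%type.
have [Z [ZL indZ]] := Linf #|{: T}|.+1.
have H (li : 'I_#|{: T}|.+1 * 'I_r) : exists h : B, (msize h <= N)%N /\
    jetV None j (vact (hat (Z li.1)) (ract (x li.2) e) - h).
  pose Y : Lelt L := exist _ (Z li.1) (ZL li.1).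
  have aY : annV j (letter Y * x li.2).
    by move=> g Vg; rewrite ractM ract_letter; apply: jetV_hat; apply: ax.
  by have := HN _ aY; rewrite ractM ract_letter.
have [h hP] := choice H.
have [|mu [[l0 mu0] Hmu]] := @lin_system k {: T} 'I_#|{: T}|.+1
    (fun im l => (h (l, im.1))@_(im.2)); first by rewrite card_ord.
exists (\sum_l mu l *: Z l); split.
- exact: mem_lincomb.
- by apply/eqP => /indZ/(_ l0)/eqP; rewrite (negPf mu0).
move=> i; rewrite (lin_comb _ _ _ (vact_hat_linl _)).
have -> : \sum_l mu l *: vact (hat (Z l)) (ract (x i) e) =
    \sum_l mu l *: (vact (hat (Z l)) (ract (x i) e) - h (l, i)).
  apply/esym; under eq_bigr do rewrite scalerBr.
  rewrite sumrB; suff -> : \sum_l mu l *: h (l, i) = 0 by rewrite subr0.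
  apply/mpolyP => m; rewrite mcoeff0 raddf_sum /=.
  under eq_bigr do rewrite mcoeffZ.
  have [lt_m|ge_m] := ltnP (mdeg m) N; first exact: (Hmu (i, BMultinom lt_m)).
  rewrite big1 // => l _; suff -> : (h (l, i))@_m = 0 by rewrite mulr0.
  apply/eqP; rewrite mcoeff_eq0; apply: msize_mdeg_ge.
  by apply: leq_trans ge_m; case: (hP (l, i)).
by apply: jetV_sum => l _; apply: jetVZ; case: (hP (l, i)).
Qed.

Variables (D : nat) (X : 'I_D -> Witt k n).
Hypothesis XL : forall i, X i \in L.
Implicit Types lam : 'M[k]_D.

Definition quad lam : A := \sum_i \sum_j lam i j *:
  (letter (exist _ (X i) (XL i) : Lelt L) * letter (exist _ (X j) (XL j) : Lelt L)).

Lemma ract_quad lam g : ract (quad lam) g = qact X lam g.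
Proof.
rewrite ract_sum; apply: eq_bigr => i _; rewrite ract_sum; apply: eq_bigr => j _.
by rewrite ractZ ractM !ract_letter.
Qed.

(** One hyperplane serves all [lam]: the symmetric [lam] vanishing to order [j] form a
    finite-dimensional space, a single nonzero [Y] kills the jets of a basis, and the hyperplane is
    taken where a component of [Y] does not vanish. *)
Lemma exists_step j : (4 <= j)%N -> exists ac : 'I_n * k, forall lam,
  lam^T = lam -> vanish X None j lam ->
  (forall a b ga, mdeg ga = j -> hyp ac (Psi X lam a b 0 ga) = 0) ->
  vanish X None j.+1 lam.
Proof.
move=> j4; pose Q lam := lam^T = lam /\ vanish X None j lam.
have [|z u v [su vu] [sv vv]|U UQ] := @subspace_vspace k 'M[k]_D Q.
- split; first by rewrite trmx0.
  apply/vanishN => a b be ga _; rewrite /Psi big1 // => i _; rewrite big1 // => l _.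
  by rewrite mxE scale0r.
- by split; [rewrite linearP /= su sv | apply: vanish_lin].
have [|Y [YL Y0 HY]] := @exists_killer j.+1 (\dim U) (fun i => quad (vbasis U)`_i).
  move=> i g Vg; rewrite ract_quad; apply: (jetV_qact (J := j) (r' := 3)) => //; last by rewrite addn2 addn3.
  suff /UQ[] : (vbasis U)`_i \in U by [].
  by apply: vbasis_mem; rewrite mem_nth // size_tuple.
have {}HY lam : Q lam -> jetV None j.+1 (vact (hat Y) (qact X lam e)).
  move=> /UQ/coord_vbasis ->.
  rewrite (lin_comb (F := fun lam => qact X lam e)); last by move=> ? ? ?; apply: qact_lin.
  rewrite vact_sum; apply: jetV_sum => i _; rewrite linearZ; apply: jetVZ.
  by have := HY i; rewrite ract_quad.
have [a Ya] : exists a, Y a != 0.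
  apply: contrapT => /forallNP H; case/eqP: Y0; apply/ffunP => a; rewrite ffunE.
  by apply/eqP/negPn/negP/H.
have [z Hz] := exists_hyp_neq0 char0 a Ya.
exists (a, z) => lam sym van Hh; apply: (vanish_step char0 sym j4 van Hh Hz).
exact: HY.
Qed.

End Annihilator.

(** * Counting monomials and conditions *)

Section Counting.
Variable n : nat.

Definition mnm_of q (g : {ffun 'I_n -> 'I_q}) : 'X_{1..n} :=
  [multinom (g i : nat) | i < n].

Lemma mnm_ofP q (m : 'X_{1..n}) : (forall i, (m i < q)%N) -> exists g, @mnm_of q g = m.
Proof.
move=> H; exists [ffun i => Ordinal (H i)]; apply/mnmP => i.
by rewrite /mnm_of mnmE ffunE.
Qed.

(** Exponents of monomials free of [x_a]; restriction to a hyperplane thus saves one power of the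
    degree. *)
Definition mnm_of_lift (a : 'I_n.+1) q (g : {ffun 'I_n -> 'I_q}) : 'X_{1..n.+1} :=
  [multinom (if unlift a i is Some i' then g i' : nat else 0%N) | i < n.+1].

Lemma mnm_of_liftP a q (m : 'X_{1..n.+1}) : m a = 0%N -> (forall i, (m i < q)%N) ->
  exists g, @mnm_of_lift a q g = m.
Proof.
move=> ma H; exists [ffun i => Ordinal (H (lift a i))]; apply/mnmP => i.
by rewrite /mnm_of_lift mnmE; case: unliftP => [i' ->|->]; rewrite ?ffunE.
Qed.

End Counting.

Section CountingBound.
Variables (k : fieldType) (n' : nat).
Local Notation n := n'.+1.
Variable L : {pred Witt k n}.
Hypothesis char0 : [pchar k] =i pred0.
Hypothesis Lsub : is_Lie_subalgebra L.
Hypothesis noeth : quot_right_noetherian (@UL_ideal _ _ L).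
Hypothesis Linf : forall q, exists Z : 'I_q -> Witt k n, (forall i, Z i \in L) /\ findep Z.

Lemma dle_Psi D (X : 'I_D -> Witt k n) m lam a b be ga :
  (forall i c, dle m (X i c)) -> dle (m + m)%N (Psi X lam a b be ga).
Proof.
move=> dX; apply: dle_sum => i _; apply: dle_sum => j _; apply: dleZ.
have dd c l de : dle m (X l c)^`M[de].
  by apply: leq_trans (msize_mderivm _ _) _; apply: leq_trans (leq_subr _ _) (dX l c).
exact: dleM.
Qed.

Lemma dle_mcoeff d (f : {mpoly k[n]}) : dle d f ->
  (forall m : 'X_{1..n}, (forall i, (m i < d.+1)%N) -> m \in msupp f -> f@_m = 0) -> f = 0.
Proof.
move=> df H; apply/mpolyP => m; rewrite mcoeff0.
have [mf|] := boolP (m \in msupp f); last by rewrite -mcoeff_eq0 => /eqP.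
apply: H => // i; apply: leq_trans df; apply: leq_ltn_trans (msize_mdeg_lt mf).
exact: mnm_le_mdeg.
Qed.

(** Number of conditions on a tensor of fields of degree at most [m]: all coefficients of jets of
    order below 4, then those of higher jets restricted to hyperplanes. The coefficients have degree
    at most [2 m]. *)
Definition count_bound m : nat :=
  (n * n * (4 ^ n * (m + m).+1 ^ n) + n * n * (m.+1 ^ n * (m + m).+1 ^ n'))%N.

(** With more than [count_bound m] symmetric products, some nontrivial combination meets all
    conditions, hence vanishes to every order by [exists_step], hence is zero. *)
Lemma independent_count m h (X : 'I_(h + h) -> Witt k n) :
  (forall i, X i \in L) -> findep X -> (forall i a, dle m (X i a)) ->
  (h * h <= count_bound m)%N.
Proof.
move=> XL indX dX; rewrite leqNgt; apply/negP => lt_h.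
have step j : exists ac : 'I_n * k, (4 <= j)%N -> forall lam,
    lam^T = lam -> vanish X None j lam ->
    (forall a b ga, mdeg ga = j -> hyp ac (Psi X lam a b 0 ga) = 0) ->
    vanish X None j.+1 lam.
  have [j4|j4] := leqP 4 j; last by exists (ord0, 0).
  by have [ac H] := exists_step char0 Lsub noeth Linf XL j4; exists ac => _.
have [ac Hac] := choice step.
(* Symmetric products of the first [h] fields with the last [h]; they occupy distinct matrix
   positions, so [lam] determines [mu]. *)
pose E (t : 'I_h * 'I_h) : 'M[k]_(h + h) :=
  delta_mx (lshift h t.1) (rshift h t.2) + delta_mx (rshift h t.2) (lshift h t.1).
pose I1 : finType := ('I_n * 'I_n * ({ffun 'I_n -> 'I_4} * {ffun 'I_n -> 'I_(m + m).+1}))%type.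
pose I2 : finType := ('I_n * 'I_n * ({ffun 'I_n -> 'I_m.+1} * {ffun 'I_n' -> 'I_(m + m).+1}))%type.
pose F1 (i : I1) lam := (Psi X lam i.1.1 i.1.2 0 (mnm_of i.2.1))@_(mnm_of i.2.2).
pose F2 (i : I2) lam := let ga := mnm_of i.2.1 in let ac' := ac (mdeg ga) in
  (hyp ac' (Psi X lam i.1.1 i.1.2 0 ga))@_(mnm_of_lift ac'.1 i.2.2).
pose F (i : I1 + I2) lam := match i with inl i => F1 i lam | inr i => F2 i lam end.
have FL i z u v : F i (z *: u + v) = z * F i u + F i v.
  case: i => i; rewrite /F /F1 /F2 /= Psi_lin; first by rewrite mcoeffD mcoeffZ.
  by rewrite [hyp _ _]raddfD /= linearZ mcoeffD mcoeffZ.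
have [|mu [[t0 mu0] Hmu]] := @lin_system k (I1 + I2)%type ('I_h * 'I_h)%type (fun i t => F i (E t)).
  rewrite card_sum !card_prod !card_ffun !card_ord; exact: lt_h.
pose lam := \sum_t mu t *: E t.
have Flam i : F i lam = 0.
  rewrite /lam -[RHS](Hmu i); apply: (lin_comb (W := k^o) (F := F i)).
  by move=> z u v; apply: FL.
have sym : lam^T = lam.
  rewrite /lam raddf_sum; apply: eq_bigr => t _ /=.
  by rewrite linearZ /= /E linearD /= !trmx_delta addrC.
have van j : vanish X None j lam.
  elim: j => [|j IH]; first by move=> a b be ga; rewrite ltn0.
  have [j4|j4] := ltnP j 4.
    apply/vanishN => a b be ga; rewrite ltnS leq_eqVlt => /orP[/eqP dj|]; last first.
      by move/vanishN: IH; apply.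
    rewrite (Psi_shift _ _ IH dj); set de := (be + ga)%MM.
    suff -> : Psi X lam a b 0 de = 0 by rewrite scaler0.
    have dde : mdeg de = j by rewrite mdegD.
    apply: (dle_mcoeff (dle_Psi _ _ _ _ _ dX)) => q Hq _.
    have [g1 <-] : exists g, @mnm_of _ 4 g = de.
      by apply: mnm_ofP => i; apply: leq_ltn_trans (mnm_le_mdeg _ _) _; rewrite dde.
    have [g2 <-] := mnm_ofP Hq.
    exact: (Flam (inl (a, b, (g1, g2)))).
  apply: (Hac j j4) => // a b ga dga.
  (* Fields of degree at most [m] have no nonzero derivatives of order above [m]. *)
  have [le_j|lt_j] := leqP j m; last first.
    suff -> : Psi X lam a b 0 ga = 0 by rewrite raddf0.
    rewrite /Psi big1 // => i _; rewrite big1 // => l _.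
    suff -> : (X l b)^`M[ga] = 0 by rewrite mulr0 scaler0.
    apply/eqP; rewrite -msize_poly_eq0 -leqn0; apply: leq_trans (msize_mderivm _ _) _.
    by rewrite leqn0 subn_eq0 dga; apply: leq_trans (dX l b) lt_j.
  apply: (dle_mcoeff (hyp_dle _ (dle_Psi _ _ _ _ _ dX))) => q Hq qf.
  have [g1 E1] : exists g, @mnm_of _ m.+1 g = ga.
    by apply: mnm_ofP => i; apply: leq_ltn_trans (mnm_le_mdeg _ _) _; rewrite dga ltnS.
  have q0 : q (ac j).1 = 0%N by apply: msupp_mderiv char0 _ _ _ (mderiv_hyp _ _) qf.
  have [g2 E2] := mnm_of_liftP q0 Hq.
  by have := Flam (inr (a, b, (g1, g2))); rewrite /F /F2 /= E1 dga E2.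
(* A tensor vanishing to all orders is zero; independence of [X] is used once in each factor. *)
have lam0 i j : lam i j = 0.
  have Hj a : \sum_i0 lam i0 j *: X i0 a = 0.
    apply: (independent_relation char0 (h := fun j => \sum_i0 lam i0 j *: X i0 a) indX) => b ga.
    have /vanishN/(_ a b 0%MM ga) := van (mdeg ga).+1; rewrite mdeg0 add0n ltnS leqnn.
    move=> /(_ isT); rewrite /Psi exchange_big => H; rewrite -[RHS]H; apply: eq_bigr => l _.
    rewrite mulr_suml; apply: eq_bigr => i0 _.
    by rewrite mderivm0m scalerAl.
  have HX : \sum_i0 lam i0 j *: X i0 = 0.
    apply/ffunP => a; rewrite sum_ffunE [RHS]ffunE -[RHS](Hj a).
    by apply: eq_bigr => i0 _; rewrite ffunE.
  exact: (indX _ HX).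
case/eqP: mu0; have := lam0 (lshift h t0.1) (rshift h t0.2).
rewrite /lam summxE (bigD1 t0) //= [X in _ + X]big1 ?addr0.
  by rewrite !mxE !eqxx eq_rlshift andbF mulr1n mulr0n addr0 mulr1.
move=> t tt0; rewrite !mxE eq_rlshift !andbF (inj_eq (@lshift_inj _ _)) (inj_eq (@rshift_inj _ _)).
rewrite addr0 -xpair_eqE -!surjective_pairing eq_sym (negPf tt0).
by rewrite mulr0.
Qed.

End CountingBound.

(** * Dimension bounds and growth *)

Section SizeBound.
Variables (k : fieldType) (n' : nat).
Local Notation n := n'.+1.
Variable L : {pred Witt k n}.
Hypothesis char0 : [pchar k] =i pred0.
Hypothesis Lsub : is_Lie_subalgebra L.
Hypothesis noeth : quot_right_noetherian (@UL_ideal _ _ L).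

Lemma findep_widen (V : lmodType k) q r (le_rq : (r <= q)%N) (X : 'I_q -> V) :
  findep X -> findep (fun i => X (widen_ord le_rq i)).
Proof.
move=> indX c c0 i.
pose c' (j : 'I_q) := if insub (j : nat) is Some i then c i else 0.
have E l : c' (widen_ord le_rq l) = c l by rewrite /c' /= valK.
rewrite -E; apply: indX; rewrite -[RHS]c0.
rewrite (bigID (fun j : 'I_q => (j < r)%N)) /= [X in _ + X]big1 ?addr0.
  by rewrite (big_ord_narrow le_rq); apply: eq_bigr => l _; rewrite E.
by move=> j jr; rewrite /c' insubN // scale0r.
Qed.

Lemma count_bound_le : exists C, forall m, (count_bound n' m <= C * m.+1 ^ (n' + n))%N.
Proof.
exists (n * n * (4 ^ n * 2 ^ n) + n * n * 2 ^ n')%N => m.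
have le2 r : ((m + m).+1 ^ r <= 2 ^ r * m.+1 ^ r)%N.
  by rewrite -expnMn; case: r => [//|r]; rewrite leq_exp2r //; lia.
rewrite /count_bound mulnDl; apply: leq_add.
  rewrite -!mulnA !leq_mul2l; apply/orP; right; apply/orP; right.
  apply/orP; right; apply: leq_trans (le2 n) _; rewrite leq_mul2l; apply/orP; right.
  by apply: leq_pexp2l => //; apply: leq_addl.
rewrite -[X in (_ <= X)%N]mulnA leq_mul2l; apply/orP; right.
by rewrite mulnC expnD mulnA; apply: leq_mul (le2 n') (leqnn _).
Qed.

(** The exponent [n' + n] is [2 n - 1], so independent families of degree at most [m] have size
    [O(m ^ (n - 1/2))]. If [L] is finite-dimensional, a constant bound suffices. *)
Lemma independent_size_bound : exists C, forall m (s : seq (Witt k n)),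
  (forall x, x \in s -> x \in L) -> lin_indep s ->
  (forall x a, x \in s -> dle m (x a)) ->
  (size s ^ 2 <= C * m.+1 ^ (n' + n))%N.
Proof.
have [Linf|/existsNP[q0 Hq0]] := pselect (forall q, exists Z : 'I_q -> Witt k n,
    (forall i, Z i \in L) /\ findep Z); last first.
  exists (q0 ^ 2)%N => m s sL inds _.
  apply: (@leq_trans (q0 ^ 2)); last by rewrite leq_pmulr // expn_gt0.
  rewrite leq_exp2r // leqNgt; apply/negP => /ltnW le_q; apply: Hq0.
  exists (fun i => s`_(widen_ord le_q i)); split; last exact: (findep_widen (X := fun i : 'I_(size s) => s`_i) inds).
  by move=> i; apply: sL; apply: mem_nth; apply: (leq_trans (ltn_ord i)) (le_q).
have [C HC] := count_bound_le; exists (9 * C + 1)%N => m s sL inds dles.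
have le_h : ((size s)./2 + (size s)./2 <= size s)%N by rewrite addnn; lia.
set h := (size s)./2 in le_h.
(* The constant [9 C + 1] comes from [(2 h + 1)^2 <= 9 h^2 + 1]. *)
have Hs : (size s <= h + h + 1)%N.
  by rewrite -[size s]odd_double_half -/h addnn addnC leq_add2l; case: odd.
have : (h * h <= C * m.+1 ^ (n' + n))%N.
  apply: leq_trans (HC m).
  apply: (independent_count char0 Lsub noeth Linf (X := fun i => s`_(widen_ord le_h i))).
  - by move=> i; apply: sL; apply: mem_nth; apply: (leq_trans (ltn_ord i)) (le_h).
  - exact: (findep_widen (X := fun i : 'I_(size s) => s`_i) inds).
  - by move=> i a; apply: dles; apply: mem_nth; apply: (leq_trans (ltn_ord i)) (le_h).
have : (0 < m.+1 ^ (n' + n))%N by rewrite expn_gt0.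
move: (m.+1 ^ (n' + n))%N => M M0 hM; apply: (@leq_trans ((h + h + 1) ^ 2)).
  by rewrite leq_exp2r.
rewrite mulnDl mul1n -mulnA; apply: (@leq_trans (9 * (h * h) + 1)%N); last first.
  by rewrite leq_add // leq_mul2l.
by rewrite expnS expn1; case: h {le_h Hs hM} => // h; nia.
Qed.

Definition wdle m (x : Witt k n) := (x \in L) /\ forall a, dle m (x a).

Lemma wdle_lin m z x y : wdle m x -> wdle m y -> wdle m (z *: x + y).
Proof.
case: Lsub => _ LD LZ _ [xL dx] [yL dy]; split; first exact: LD (LZ _ _ xL) yL.
move=> a; rewrite wittP /dle; apply: (leq_trans (msizeD_le _ _)).
by rewrite geq_max; apply/andP; split; [apply: dleZ | apply: dy].
Qed.

Lemma wdle_span m (A : set (Witt k n)) : (forall x, A x -> wdle m x) ->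
  forall x, Defs.span A x -> wdle m x.
Proof.
move=> H x [r [c [y [Ay ->]]]]; elim: r c y Ay => [|r IH] c y Ay.
  rewrite big_ord0; split; first by case: Lsub.
  by move=> a; rewrite ffunE /dle msize0.
by rewrite big_ord_recl; apply: wdle_lin; [apply: H | apply: IH => i].
Qed.

Lemma wdle_bracket m1 m2 x y : wdle m1 x -> wdle m2 y -> wdle (m1 + m2)%N (wbracket x y).
Proof.
case: Lsub => _ _ _ LB [xL dx] [yL dy]; split; first exact: LB.
have dd m (f : {mpoly k[n]}) i : dle m f -> dle m f^`M(i).
  by move=> df; apply: leq_trans (msize_mderiv _ _) (leq_trans (leq_pred _) df).
move=> a; rewrite ffunE; apply: dle_sum => i _; rewrite /dle.
apply: (leq_trans (msizeD_le _ _)); rewrite msizeN geq_max; apply/andP; split.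
  by apply: dleM; [|apply: dd].
by rewrite addnC; apply: dleM; [|apply: dd].
Qed.

Lemma wdleW m1 m2 x : (m1 <= m2)%N -> wdle m1 x -> wdle m2 x.
Proof. by move=> le_m [xL dx]; split=> // a; apply: leq_trans (dx a) _. Qed.

(** Degrees add up under brackets, so an [i]-fold bracket of fields of degree at most [d] has degree
    at most [(i + 1) d]. *)
Lemma wdle_Gspace (vs : seq (Witt k n)) d j : (forall x, x \in vs -> wdle d x) ->
  forall x, Gspace (@wbracket k n) vs j x -> wdle (j.+1 * d) x.
Proof.
move=> Hvs; have Hspan : forall x, Defs.span [set x | x \in vs] x -> wdle d x.
  exact: wdle_span.
have HC i x : Cspace (@wbracket k n) vs i x -> wdle (i.+1 * d) x.
  elim: i x => [|i IH] x; first by rewrite mul1n => /Hspan.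
  apply: wdle_span => _ [u Cu [v Sv <-]]; rewrite mulSn addnC.
  by apply: wdle_bracket; [apply: IH | apply: Hspan].
move=> x; apply: wdle_span => {}x [i [le_ij /HC]]; apply: wdleW.
by rewrite leq_mul2r ltnS le_ij orbT.
Qed.

Variable R : realType.

(** The dimension is at most a constant times [j ^ (n - 1/2)]; weakening the exponent to [n - 1/4]
    absorbs the constant for large [j]. *)
Lemma growth_rate_le (vs : seq (Witt k n)) : (forall x, x \in vs -> x \in L) ->
  (growth_rate R (@wbracket k n) vs <= ((n%:R - 4%:R^-1 : R)%:E))%E.
Proof.
move=> vsL; have [C HC] := independent_size_bound.
have [d Hd] : exists d, forall x, x \in vs -> wdle d x.
  exists (\max_(x <- vs) \max_a msize (x a))%N => x xvs; split; first exact: vsL.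
  move=> a; rewrite /dle; apply: leqW; apply: leq_trans (leq_bigmax_seq _ xvs _) => //.
  exact: (@leq_bigmax _ (fun a => msize (x a))).
(* Chosen through [(j + 1) d + 1 <= (2 d + 1) j] for [j >= 1]. *)
pose K := (C * (d + d).+1 ^ (n' + n))%N.
(* The limsup is at most the supremum over the tail [j >= K^2 + 2]: there [K^2 <= j], and [ln j] is
   positive. *)
apply: le_trans (ereal_inf_lbound _) _.
  exists [set j | (K * K + 2 <= j)%N]%classic; last by reflexivity.
  by exists (K * K + 2)%N.
apply: ge_ereal_sup => _ [j /= Kj <-]; rewrite lee_fin /growth_ratio.
have j2 : (2 <= j)%N by apply: leq_trans Kj; rewrite leq_addl.
have lnj : 0 < ln (j%:R : R) by apply: ln_gt0; rewrite ltr1n.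
rewrite ler_pdivrMr //; set y := (n%:R - _) * _.
have y0 : 0 <= y.
  rewrite mulr_ge0 ?(ltW lnj) // subr_ge0; apply: (@le_trans _ _ 1); last by rewrite ler1n.
  by rewrite invf_le1 ?ler1n ?ltr0n.
have j0 : 0 < j%:R :> R by rewrite ltr0n; apply: leq_trans j2.
have size_le (s : seq (Witt k n)) : (forall x, x \in s -> Gspace (@wbracket k n) vs j x) ->
    lin_indep s -> (size s)%:R <= expR y.
  move=> sG inds; case: (posnP (size s)) => [->|s0]; first exact: expR_ge0.
  have sP : 0 < (size s)%:R :> R by rewrite ltr0n.
  rewrite -[leLHS]lnK // ler_expR.
  have H4 : (size s ^ 4 <= j ^ (4 * n - 1))%N.
    have Hs : (size s ^ 2 <= K * j ^ (n' + n))%N.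
      apply: leq_trans (HC (j.+1 * d)%N s _ inds _) _.
      - by move=> x /sG/(wdle_Gspace Hd)[].
      - by move=> x a /sG/(wdle_Gspace Hd)[].
      rewrite /K -mulnA leq_mul2l; apply/orP; right.
      by rewrite -expnMn leq_exp2r ?addnS //; nia.
    apply: (@leq_trans ((K * j ^ (n' + n)) ^ 2)%N).
      by rewrite (_ : 4 = 2 * 2)%N // expnM leq_exp2r.
    rewrite expnMn -expnM (_ : 4 * n - 1 = (n' + n) * 2 + 1)%N; last by lia.
    rewrite expnD expn1 mulnC leq_mul2l; apply/orP; right.
    by apply: leq_trans Kj; rewrite expnS expn1 leq_addr.
  have : ln ((size s)%:R ^+ 4 : R) <= ln (j%:R ^+ (4 * n - 1)).
    rewrite ler_ln ?posrE ?exprn_gt0 //.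
    by rewrite -!natrX ler_nat.
  rewrite !lnXn //; set u := ln _; set v := ln _ => H.
  have : u * 4%:R <= v * (4%:R * n%:R - 1%:R).
    by rewrite -natrM -natrB ?muln_gt0 // !mulr_natr.
  rewrite /y -/v; move: (n%:R : R) => w.
  by rewrite (_ : w - 4%:R^-1 = (4%:R * w - 1%:R) / 4%:R); [rewrite mulrAC ler_pdivlMr ?ltr0n // [_ * v]mulrC | field].
have dim_le : (dimE R (Gspace (@wbracket k n) vs j) <= (expR y)%:E)%E.
  by apply: ge_ereal_sup => _ [s [sG inds] <-]; rewrite lee_fin; apply: size_le.
have dim_ge : (0 <= dimE R (Gspace (@wbracket k n) vs j))%E.
  apply: ereal_sup_ubound; exists [::] => //; split=> // c _; by case.
have fin : dimE R (Gspace (@wbracket k n) vs j) \is a fin_num.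
  by rewrite ge0_fin_numE //; apply: le_lt_trans dim_le _; rewrite ltry.
have f_le : fine (dimE R (Gspace (@wbracket k n) vs j)) <= expR y.
  by rewrite -lee_fin fineK.
(* For dimension 0 the logarithm takes its default value 0. *)
have [f0|f0] := leP (fine (dimE R (Gspace (@wbracket k n) vs j))) 0.
  by rewrite ln0.
by rewrite -[leRHS]expRK ler_ln ?posrE ?expR_gt0.
Qed.

End SizeBound.

Theorem mainTheorem13 (R : realType) (k : fieldType) (n : nat)
    (L : {pred Witt k n}) :
  [pchar k]%R =i pred0 ->
  (1 <= n)%N ->
  is_Lie_subalgebra L ->
  GKdim R (@wbracket k n) [set x | x \in L] = ((n%:R : R)%:E)%E ->
  ~ UL_noetherian L.
Proof.
case: n L => // n' L char0 _ Lsub GK [_ noeth].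
(* All growth rates are at most [n - 1/4], so their supremum is less than [n]. *)
have : (GKdim R (@wbracket k n'.+1) [set x | x \in L] <= ((n'.+1%:R - 4%:R^-1 : R)%:E))%E.
  apply: ge_ereal_sup => _ [vs /= vsL <-].
  exact: (growth_rate_le char0 Lsub noeth R vsL).
rewrite GK lee_fin leNgt => /negP; apply.
by rewrite ltrBlDr ltrDl invr_gt0 ltr0n.
Qed.
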